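(* Let $\alpha\in(0,1]$, let $X=\ell_p(\mathbb N)$ with $p\in[1,+\infty)$ or $X=c_0(\mathbb N)$, endowed with the coordinatewise product, let $\Lambda\subset\mathbb R^2$ be $\sigma$-compact, and let the weights $w(a)=(w_n(a))_{n\geq1}$, $a\in\mathbb R$, be defined by $w_1(a)\cdots w_n(a)=\exp(an^\alpha)$ for all $n\geq 1$. The following assertions are equivalent: (a) the family $(B_{w(a)}\times B_{w(b)})_{(a,b)\in\Lambda}$ has a common hypercyclic vector in $X^2$; (b) the family $(B_{w(a)}\times B_{w(b)})_{(a,b)\in\Lambda}$ has a common hypercyclic algebra in $X^2$.
   Context: Sequences are complex and indexed by $n\ge 0$. For a sequence $w=(w_n)_{n\geq 1}$ of positive real numbers, the weighted backward shift is $B_w(x_0,x_1,x_2,\dots)=(w_1x_1,w_2x_2,\dots)$; $B_{w(a)}\times B_{w(b)}$ acts on $X^2$ by $(x,y)\mapsto(B_{w(a)}x,B_{w(b)}y)$. The coordinatewise product of sequences is $(a_n)_n\cdot(b_n)_n=(a_nb_n)_n$; $X^2$ is an algebra with this product applied in each component. A vector $x$ is hypercyclic for an operator $T$ if $\{T^n(x):n\geq 1\}$ is dense in the space; $HC(T)$ is the set of hypercyclic vectors of $T$. A common hypercyclic vector for a family $(T_\lambda)_{\lambda\in\Lambda}$ is an element of $\bigcap_{\lambda\in\Lambda}HC(T_\lambda)$. A common hypercyclic algebra for the family is a non-trivial (i.e. nonzero) subalgebra $A$ of the underlying algebra with $A\setminus\{0\}\subset\bigcap_{\lambda\in\Lambda}HC(T_\lambda)$.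 *)

(* Defs.v *)
From HB Require Import structures.
From mathcomp Require Import all_boot all_order all_algebra.
From mathcomp Require Import all_classical all_reals all_analysis.
From mathcomp Require Import complex.

Set Implicit Arguments.
Unset Strict Implicit.
Unset Printing Implicit Defensive.

Import Order.TTheory GRing.Theory Num.Theory.
Import numFieldNormedType.Exports.

Local Open Scope classical_set_scope.
Local Open Scope ring_scope.

(* The library makes this function type a commutative ring and an [R[i]]-module
   for the coordinatewise operations, and likewise for pairs of sequences. *)
Notation cseq R := (nat -> R[i]).

(* The norm on [R[i]] takes its values in [R[i]]; this one is real-valued. *)
Definition cmod (R : realType) (z : R[i]) : R := ComplexField.Normc.normc z.

(* A normed space sitting inside an ambient group [V]. The norm is defined on
   all of [V], with extended real values; only its values on the difference of
   two vectors of the carrier are meaningful, and these are finite for the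
   spaces below. *)
Record normed_subspace (R : realType) (V : zmodType) := NormedSubspace {
  carrier : set V ;
  enorm : V -> \bar R
}.

Definition lp_norm (R : realType) (p : R) (x : cseq R) : \bar R :=
  Lnorm counting p%:E (fun n => (cmod (x n))%:E).

Definition lp_space (R : realType) (p : R) : normed_subspace R (cseq R) :=
  {| carrier := [set x | (lp_norm p x < +oo)%E] ;
     enorm := lp_norm p |}.

Definition c0_space (R : realType) : normed_subspace R (cseq R) :=
  {| carrier := [set x | cmod (x n) @[n --> \oo] --> (0 : R)] ;
     enorm := fun x => ereal_sup (range (fun n => (cmod (x n))%:E)) |}.

Definition square_space (R : realType) (V : zmodType) (X : normed_subspace R V) :
    normed_subspace R (V * V)%type :=
  {| carrier := carrier X `*` carrier X ;
     enorm := fun z => maxe (enorm X z.1) (enorm X z.2) |}.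

Definition dense_in (R : realType) (V : zmodType) (X : normed_subspace R V)
    (D : set V) : Prop :=
  forall u, carrier X u -> forall e : R, 0 < e ->
    exists2 v, D v & (enorm X (v - u) < e%:E)%E.

Definition HC (R : realType) (V : zmodType) (X : normed_subspace R V)
    (T : V -> V) : set V :=
  [set x | carrier X x /\
           dense_in X [set y | exists2 n, (1 <= n)%N & y = iter n T x]].

Definition common_hypercyclic_vector (R : realType) (V : zmodType)
    (X : normed_subspace R V) (I : Type) (L : set I) (T : I -> V -> V)
    (x : V) : Prop :=
  carrier X x /\ forall i, L i -> HC X (T i) x.

(* Complex subalgebras; the constant sequence 1 belongs neither to [lp_space p]
   nor to [c0_space], so there is no condition on a unit. *)
Record is_subalgebra (R : realType)
    (X : normed_subspace R (cseq R * cseq R)%type)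
    (A : set (cseq R * cseq R)%type) : Prop := IsSubalgebra {
  subalg_sub : A `<=` carrier X ;
  subalg_0 : A 0 ;
  subalg_add : forall u v, A u -> A v -> A (u + v) ;
  subalg_scale : forall (c : R[i]) u, A u -> A (c *: u) ;
  subalg_mul : forall u v, A u -> A v -> A (u * v)
}.

Definition common_hypercyclic_algebra (R : realType)
    (X : normed_subspace R (cseq R * cseq R)%type) (I : Type) (L : set I)
    (T : I -> (cseq R * cseq R)%type -> (cseq R * cseq R)%type)
    (A : set (cseq R * cseq R)%type) : Prop :=
  [/\ is_subalgebra X A,
      exists2 u, A u & u != 0 &
      forall u, A u -> u != 0 -> common_hypercyclic_vector X L T u].

(* [w n] is the weight with index [n >= 1]; [w 0] is not used. *)
Definition weighted_shift (R : realType) (w : nat -> R) (x : cseq R) : cseq R :=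
  fun n => (w n.+1)%:C%C * x n.+1.

Definition product_map (V : Type) (S T : V -> V) (z : V * V) : V * V :=
  (S z.1, T z.2).

Definition sigma_compact (T : topologicalType) (L : set T) : Prop :=
  exists K : nat -> set T, (forall n, compact (K n)) /\ L = \bigcup_n K n.

(* Main.v *)
(* From a hypercyclic vector to an algebra. Let (x, y) be a common hypercyclic vector.
   Approximating (e_0, e_0) by its orbits within eps shows that every (a, b) in a compact
   part of the parameter set is within 5 eps / n^alpha of some (A n, B n), with one
   parameter for each n of a finite set F, and that the coefficients exp(-A_k k^alpha)
   (k > n in F), which are close to |x_k|, contribute at most about eps to the orbit of
   (A n, B n) at time n, in the norm of X. These two properties survive when n is replaced
   by q n, provided that eps is small enough in terms of q; this yields arbitrarily long
   gaps and arbitrarily late indices. Writing at q n, for n in F, the finite target v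
   divided by the weights, raised to the power 1/m, gives a block Y for which
   B^(q n) (Y^m) is close to v and B^(q n) (|Y|^(m+1)) is small. A gliding hump over
   countably many targets, exponents and compact sets produces Y such that P(Y) is
   hypercyclic for every nonzero polynomial P without constant term, since P(z) is
   c z^m + O(|z|^(m+1)). *)

Require Import Defs.
From HB Require Import structures.
From mathcomp Require Import all_boot all_order all_algebra.
From mathcomp Require Import all_classical all_reals all_analysis.
From mathcomp Require Import complex.
From mathcomp Require Import ring lra.

Set Implicit Arguments.
Unset Strict Implicit.
Unset Printing Implicit Defensive.

Import Order.TTheory GRing.Theory Num.Theory.
Import numFieldNormedType.Exports.

Local Open Scope classical_set_scope.
Local Open Scope ring_scope.

(** * The sequence spaces *)

Lemma cmod_ge0 (R : realType) (z : R[i]) : 0 <= cmod z.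
Proof. by case: z => a b; exact: sqrtr_ge0. Qed.

Lemma cmodM (R : realType) (z1 z2 : R[i]) : cmod (z1 * z2) = cmod z1 * cmod z2.
Proof. exact: ComplexField.Normc.normcM. Qed.

Lemma cmodD (R : realType) (z1 z2 : R[i]) : cmod (z1 + z2) <= cmod z1 + cmod z2.
Proof. exact: le_normcD. Qed.

Lemma cmod0 (R : realType) : cmod (0 : R[i]) = 0.
Proof. exact: ComplexField.Normc.normc0. Qed.

Lemma cmod1 (R : realType) : cmod (1 : R[i]) = 1.
Proof. exact: ComplexField.Normc.normc1. Qed.

Lemma cmod_eq0 (R : realType) (z : R[i]) : (cmod z == 0) = (z == 0).
Proof.
apply/eqP/eqP => [/ComplexField.Normc.eq0_normc //|->]; exact: cmod0.
Qed.

Lemma cmodN (R : realType) (z : R[i]) : cmod (- z) = cmod z.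
Proof. exact: normcN. Qed.

Lemma cmodB (R : realType) (z1 z2 : R[i]) : cmod (z1 - z2) <= cmod z1 + cmod z2.
Proof. by rewrite -(cmodN z2); exact: cmodD. Qed.

Lemma cmodC (R : realType) (z1 z2 : R[i]) : cmod (z1 - z2) = cmod (z2 - z1).
Proof. by rewrite -cmodN opprB. Qed.

Lemma cmodX (R : realType) (z : R[i]) n : cmod (z ^+ n) = cmod z ^+ n.
Proof. by elim: n => [|n IH]; rewrite ?cmod1// !exprS cmodM IH. Qed.

Lemma cmod_real (R : realType) (a : R) : cmod (a%:C%C) = `|a|.
Proof. by rewrite /cmod /= expr0n/= addr0 sqrtr_sqr. Qed.

Lemma lp_norm_leP (R : realType) (p : R) (x : cseq R) (s : R) : 0 < p -> 0 <= s ->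
  (lp_norm p x <= s%:E)%E <->
  forall N, \sum_(0 <= k < N) cmod (x k) `^ p <= s `^ p.
Proof.
move=> p0 s0; rewrite /lp_norm Lnorm_counting//.
have tE k : (`|(cmod (x k))%:E| `^ p)%E = (cmod (x k) `^ p)%:E.
  by rewrite abse_EFin ger0_norm ?cmod_ge0.
have t0 k : (0 <= `|(cmod (x k))%:E| `^ p)%E by rewrite tE lee_fin powR_ge0.
have S0 : (0 <= \sum_(k <oo) `|(cmod (x k))%:E| `^ p)%E by exact: nneseries_ge0.
have iff1 : ((\sum_(k <oo) `|(cmod (x k))%:E| `^ p)`^ p^-1 <= s%:E)%E <->
   (\sum_(k <oo) `|(cmod (x k))%:E| `^ p <= (s `^ p)%:E)%E.
  split=> h.
    have := @gt0_ler_poweR _ p (ltW p0) _ _ _ _ h.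
    rewrite -poweRrM mulVf ?gt_eqF// poweRe1//; apply; rewrite in_itv/= leey andbT.
      exact: poweR_ge0.
    by rewrite lee_fin.
  have pV : 0 <= p^-1 by rewrite invr_ge0 ltW.
  have := @gt0_ler_poweR _ p^-1 pV _ _ _ _ h.
  rewrite poweR_EFin -powRrM mulfV ?gt_eqF// powRr1//; apply; rewrite in_itv/= leey andbT//.
  by rewrite lee_fin powR_ge0.
rewrite iff1; split=> [h N|h].
  rewrite -lee_fin; apply: le_trans h; rewrite -sumEFin.
  apply: le_trans (nneseries_lim_ge N _); last by [].
  by apply: lee_sum => k _; rewrite tE.
apply: lime_le; first exact: is_cvg_nneseries.
apply: nearW => N; under eq_bigr do rewrite tE.
by rewrite sumEFin lee_fin.
Qed.

Lemma c0_norm_leP (R : realType) (x : cseq R) (s : R) :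
  (enorm (c0_space R) x <= s%:E)%E <-> forall n, cmod (x n) <= s.
Proof.
split=> [h n|h].
  rewrite -lee_fin; apply: le_trans h; apply: ereal_sup_ubound.
  by exists n.
by apply: ub_ereal_sup => _ [n _ <-]; rewrite lee_fin.
Qed.

Definition lp_or_c0 (R : realType) (X : normed_subspace R (cseq R)) : Prop :=
  (exists2 p : R, 1 <= p & X = lp_space p) \/ X = c0_space R.

(** [f] stands for a majorant of the moduli of a vector. Since [enorm] depends only on the moduli
    and increases with them, all estimates below are made on such real sequences. *)
Definition norm_le (R : realType) (X : normed_subspace R (cseq R))
    (f : nat -> R) (s : R) : Prop :=
  (enorm X (fun n => (f n)%:C%C) <= s%:E)%E.

Section SequenceSpaces.
Variables (R : realType) (X : normed_subspace R (cseq R)).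
Hypothesis hX : lp_or_c0 X.

(** Every term is at most [s], so its [p]-th power is at most [s ^ (p - 1)] times the term, and
    these bounds sum to at most [s ^ p]. *)
Lemma norm_le_l1 (f : nat -> R) (s : R) : (forall n, 0 <= f n) ->
  (forall N, \sum_(0 <= n < N) f n <= s) -> norm_le X f s.
Proof.
move=> f0 fs; have s0 : 0 <= s by have := fs 0; rewrite big_geq.
have fle n : f n <= s.
  apply: le_trans (fs n.+1); rewrite big_nat_recr//= lerDr.
  by apply: sumr_ge0.
case: hX => [[p p1 ->]|->]; rewrite /norm_le.
- have p0 : 0 < p by apply: lt_le_trans p1.
  apply/lp_norm_leP => // N.
  rewrite -(mulr_powRB1 s0 p0); apply: le_trans (ler_wpM2r (powR_ge0 _ _) (fs N)).
  rewrite mulr_suml; apply: ler_sum => n _.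
  rewrite cmod_real ger0_norm// -(mulr_powRB1 (f0 n) p0).
  by apply: ler_wpM2l => //; apply: ge0_ler_powR; rewrite ?subr_ge0// nnegrE.
- by apply/c0_norm_leP => n; rewrite cmod_real ger0_norm.
Qed.

Lemma carrier_l1 (x : cseq R) (s : R) :
  (forall N, \sum_(0 <= n < N) cmod (x n) <= s) -> carrier X x.
Proof.
move=> fs.
have := @norm_le_l1 (fun n => cmod (x n)) s (fun n => cmod_ge0 _) fs.
have xE n : cmod (cmod (x n))%:C%C = cmod (x n) by rewrite cmod_real ger0_norm ?cmod_ge0.
have s0 : 0 <= s by have := fs 0; rewrite big_geq.
case: hX => [[p p1 ->]|->]; rewrite /norm_le => h /=.
- have p0 : 0 < p by apply: lt_le_trans p1.
  apply: (@le_lt_trans _ _ s%:E); last exact: ltry.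
  move/(lp_norm_leP _ p0 s0) : h => h; apply/lp_norm_leP => // N.
  by under eq_bigr do rewrite -xE.
- apply: (@cvg_series_cvg_0 _ _ (fun n => cmod (x n))).
  apply: nondecreasing_is_cvgn.
    move=> a b ab; rewrite /series/= (big_cat_nat (leq0n _) ab)//= lerDl.
    by apply: sumr_ge0 => *; exact: cmod_ge0.
  by exists s => _ [n _ <-]; exact: fs.
Qed.

Lemma enorm_mono (x y : cseq R) : (forall n, cmod (x n) <= cmod (y n)) ->
  (enorm X x <= enorm X y)%E.
Proof.
move=> xy; case: hX => [[p p1 ->]|->].
- have p0 : 0 < p by apply: lt_le_trans p1.
  have pV : 0 <= p^-1 by rewrite invr_ge0 ltW.
  rewrite /= /lp_norm !Lnorm_counting//; apply: gt0_ler_poweR => //.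
  + by rewrite in_itv/= leey andbT; apply: nneseries_ge0 => *; rewrite lee_fin powR_ge0.
  + by rewrite in_itv/= leey andbT; apply: nneseries_ge0 => *; rewrite lee_fin powR_ge0.
  apply: lee_nneseries => [*|n _]; first by rewrite lee_fin powR_ge0.
  rewrite /= lee_fin; apply: ge0_ler_powR; rewrite ?nnegrE//; first exact: ltW.
  by rewrite !ger0_norm ?cmod_ge0.
- apply: ub_ereal_sup => _ [n _ <-].
  apply: (@le_trans _ _ (cmod (y n))%:E); first by rewrite lee_fin.
  by apply: ereal_sup_ubound; exists n.
Qed.

Lemma enorm_norm_le (x : cseq R) (f : nat -> R) (s : R) :
  (forall n, cmod (x n) <= f n) -> norm_le X f s -> (enorm X x <= s%:E)%E.
Proof.
move=> xf; apply: le_trans; apply: enorm_mono => n.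
by rewrite cmod_real; apply: le_trans (ler_norm _).
Qed.

Lemma norm_le_enorm (x : cseq R) (f : nat -> R) (s : R) :
  (forall n, `|f n| <= cmod (x n)) -> (enorm X x <= s%:E)%E -> norm_le X f s.
Proof.
by move=> xf; apply: le_trans; apply: enorm_mono => n; rewrite cmod_real.
Qed.

Lemma norm_le_mono (f g : nat -> R) (s : R) :
  (forall n, 0 <= f n <= g n) -> norm_le X g s -> norm_le X f s.
Proof.
move=> fg; apply: enorm_norm_le => n; rewrite cmod_real.
by case/andP: (fg n) => f0; rewrite ger0_norm.
Qed.

Lemma cmod_le_enorm (x : cseq R) n : ((cmod (x n))%:E <= enorm X x)%E.
Proof.
case: hX => [[p p1 ->]|->]; last by apply: ereal_sup_ubound; exists n.
have p0 : 0 < p by apply: lt_le_trans p1.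
rewrite -[X in (X <= _)%E]/((cmod (x n))%:E); rewrite leNgt; apply/negP.
move=> h.
have : (0%:E <= enorm (lp_space p) x)%E by rewrite /= /lp_norm Lnorm_ge0.
move: h; case E: (enorm _ x) => [s| |]//; rewrite lte_fin lee_fin => h s0.
have /(lp_norm_leP _ p0 s0)/(_ n.+1) : (lp_norm p x <= s%:E)%E by rewrite -E.
rewrite big_nat_recr//= leNgt => /negP; apply.
apply: (@lt_le_trans _ _ (cmod (x n) `^ p)).
  by apply: gt0_ltr_powR; rewrite ?nnegrE ?cmod_ge0.
by rewrite lerDr; apply: sumr_ge0 => *; exact: powR_ge0.
Qed.

Lemma norm_le_coord (f : nat -> R) (s : R) n : norm_le X f s -> `|f n| <= s.
Proof.
move=> h; rewrite -cmod_real -lee_fin; apply: le_trans h.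
exact: (cmod_le_enorm (fun k => (f k)%:C%C)).
Qed.

Lemma norm_le_ge0 (f : nat -> R) (s : R) : norm_le X f s -> 0 <= s.
Proof. by move/(norm_le_coord 0); apply: le_trans. Qed.

Lemma norm_leD (f g : nat -> R) (s t : R) : (forall n, 0 <= f n) ->
  (forall n, 0 <= g n) -> norm_le X f s -> norm_le X g t ->
  norm_le X (fun n => f n + g n) (s + t).
Proof.
move=> f0 g0 fs gt; have := norm_le_ge0 fs; have := norm_le_ge0 gt => t0 s0.
move: fs gt; rewrite /norm_le.
have E (h : nat -> R) : (forall n, 0 <= h n) -> (fun n => (cmod ((h n)%:C%C : R[i]))%:E) = EFin \o h.
  by move=> h0; apply/funext => n; rewrite cmod_real ger0_norm.
case: hX => [[p p1 ->]|->].
- have lpE x : enorm (lp_space p) x = Lnorm counting p%:E (fun n => (cmod (x n))%:E).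
    by [].
  rewrite !lpE (E _ f0) (E _ g0) (E (fun n => f n + g n)); last first.
    by move=> n; rewrite addr_ge0.
  move=> fs gt.
  have := @minkowski_EFin _ _ R counting f g p _ _ p1.
  rewrite EFinD; move/(_ _ _)/le_trans; apply=> //.
  exact: leeD.
- move=> /c0_norm_leP fs /c0_norm_leP gt; apply/c0_norm_leP => n.
  move: (fs n) (gt n); rewrite !cmod_real => fn gn.
  by apply: le_trans (ler_normD _ _) _; apply: lerD.
Qed.

Lemma norm_leZ (f : nat -> R) (s t : R) : 0 <= t ->
  norm_le X f s -> norm_le X (fun n => t * f n) (t * s).
Proof.
move=> t0 fs; have := norm_le_ge0 fs => s0.
move: fs; rewrite /norm_le; case: hX => [[p p1 ->]|->].
- have p0 : 0 < p by apply: lt_le_trans p1.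
  move=> /(lp_norm_leP _ p0 s0) h; apply/lp_norm_leP => //; first exact: mulr_ge0.
  move=> N; rewrite powRM//; apply: le_trans (ler_wpM2l (powR_ge0 _ _) (h N)).
  rewrite mulr_sumr; apply: ler_sum => n _.
  by rewrite !cmod_real normrM powRM// (ger0_norm t0).
- move=> /c0_norm_leP fs; apply/c0_norm_leP => n.
  by have := fs n; rewrite !cmod_real normrM (ger0_norm t0) => ?; rewrite ler_wpM2l.
Qed.

(** Every value is repeated [q] times, which multiplies the sum of [p]-th powers by [q], at most
    [q ^ p] because [p >= 1]. This is the price of the dilation from [n] to [q * n]. *)
Lemma norm_le_stretch (q : nat) (f : nat -> R) (s : R) : (0 < q)%N ->
  norm_le X f s -> norm_le X (fun n => f (n %/ q)%N) (q%:R * s).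
Proof.
move=> q0 fs; have s0 := norm_le_ge0 fs.
move: fs; rewrite /norm_le; case: hX => [[p p1 ->]|->].
- have p0 : 0 < p by apply: lt_le_trans p1.
  move=> /(lp_norm_leP _ p0 s0) h; apply/lp_norm_leP => //; first exact: mulr_ge0.
  move=> N; rewrite powRM//.
  apply: (@le_trans _ _ (\sum_(0 <= n < N * q) cmod ((f (n %/ q)%N)%:C)%C `^ p)).
    rewrite (big_cat_nat (leq0n N) (leq_pmulr N q0))//= lerDl.
    by apply: sumr_ge0 => *; exact: powR_ge0.
  rewrite big_nat_mul/=.
  apply: (@le_trans _ _ (q%:R * s `^ p)); last first.
    apply: ler_wpM2r; first exact: powR_ge0.
    by apply: le1r_powR => //; rewrite ler1n.
  apply: le_trans (ler_wpM2l _ (h N)) => //; rewrite mulr_sumr.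
  apply: ler_sum_nat => n _.
  rewrite (eq_big_nat _ _ (F2 := fun=> cmod ((f n)%:C)%C `^ p)); last first.
    move=> j /andP[nj jn]; congr (cmod ((f _)%:C)%C `^ p).
    by apply/eqP; rewrite eqn_leq leq_divRL// nj andbT -ltnS ltn_divLR.
  by rewrite sumr_const_nat mulSn addnK mulr_natl.
- move=> /c0_norm_leP fs; apply/c0_norm_leP => n.
  by apply: le_trans (fs _) _; rewrite ler_peMl// ler1n.
Qed.

Lemma carrier_bounded (x : cseq R) : carrier X x -> exists s, forall n, cmod (x n) <= s.
Proof.
have [[p p1 XE] /= xX|XE] := hX.
- exists (fine (enorm X x)) => n.
  have xfin : (enorm X x \is a fin_num).
    rewrite ge0_fin_numE; first by move: xX; rewrite XE.
    by apply: le_trans (cmod_le_enorm x 0); rewrite lee_fin cmod_ge0.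
  by rewrite -lee_fin fineK//; exact: cmod_le_enorm.
- rewrite XE => /= xX.
  have [M [_ HM]] := @cvg_seq_bounded _ _ _ (cvgP _ xX).
  exists (M + 1) => n; apply: le_trans (ler_norm _) _.
  by apply: (HM (M + 1)) => //; rewrite ltrDl.
Qed.

Lemma trunc_dense (u : cseq R) (e : R) : carrier X u -> 0 < e ->
  exists N, (enorm X (fun n => if (n < N)%N then 0 else u n)%R <= e%:E)%E.
Proof.
case: hX => [[p p1 ->]|->] uX e0.
- have p0 : 0 < p by apply: lt_le_trans p1.
  have /fineK sE : lp_norm p u \is a fin_num by rewrite ge0_fin_numE// Lnorm_ge0.
  set s := fine _ in sE.
  have s0 : 0 <= s by apply: fine_ge0; rewrite Lnorm_ge0.
  have /(lp_norm_leP _ p0 s0) us : (lp_norm p u <= s%:E)%E by rewrite sE.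
  pose t N := \sum_(0 <= k < N) cmod (u k) `^ p.
  have tcvg : cvgn t.
    apply: nondecreasing_is_cvgn.
      move=> a b ab; rewrite /t (big_cat_nat (leq0n _) ab)//= lerDl.
      by apply: sumr_ge0 => *; exact: powR_ge0.
    by exists (s `^ p) => _ [n _ <-]; exact: us.
  have ep : 0 < e `^ p by rewrite powR_gt0.
  have tle n : t n <= limn t.
    apply: nondecreasing_cvgn_le => // a b ab; rewrite /t (big_cat_nat (leq0n _) ab)//= lerDl.
    by apply: sumr_ge0 => *; exact: powR_ge0.
  have [N _ HN] : \forall N \near \oo, `|limn t - t N| < e `^ p.
    by move/cvgrPdist_lt : tcvg => /(_ _ ep).
  exists N; apply/lp_norm_leP => //; first exact: ltW.
  move=> M; apply: (@le_trans _ _ (limn t - t N)); last first.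
    apply: le_trans (ler_norm _) _; apply/ltW; apply: HN; exact: leqnn.
  have [MN|NM] := leqP M N.
    rewrite big_nat big1 ?subr_ge0// => k /andP[_ kM].
    by rewrite (leq_trans kM MN) cmod0 powR0// gt_eqF.
  rewrite (big_cat_nat (leq0n _) (ltnW NM))//= big_nat big1 ?add0r; last first.
    by move=> k /andP[_ ->]; rewrite cmod0 powR0// gt_eqF.
  rewrite lerBrDr addrC; apply: le_trans (tle M).
  rewrite [leRHS](big_cat_nat (leq0n _) (ltnW NM))//=; apply: lerD => //.
  by apply: ler_sum_nat => k /andP[Nk _]; rewrite ltnNge Nk.
- have [N _ HN] : \forall n \near \oo, `|0 - cmod (u n)| < e.
    by move/cvgrPdist_lt : uX => /(_ _ e0).
  exists N; apply/c0_norm_leP => n; case: ltnP => nN; first by rewrite cmod0 ltW.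
  by have := HN n nN; rewrite sub0r normrN ger0_norm ?cmod_ge0// => /ltW.
Qed.
End SequenceSpaces.

(** * Powers and decay *)

Lemma expR_dist1 (R : realType) (t d : R) : `|t| <= d -> d <= 2^-1 -> `|expR t - 1| <= 2 * d.
Proof.
move=> td d2; have [t0 t1] : - d <= t /\ t <= d by apply/andP; rewrite -ler_norml.
have h1 := expR_ge1Dx t; have h2 := expR_ge1Dx (- t).
have eP := expR_gt0 t.
(* The lower bound for [expR (- t)] becomes an upper bound for [expR t], namely the inverse of
   [1 - t]. *)
have h3 : (1 - t) * expR t <= 1.
  have := ler_wpM2r (ltW eP) h2; rewrite -expRD addNr expR0.
  by apply: le_trans.
by rewrite ler_norml; apply/andP; split; nra.
Qed.

Section Powers.
Variables (R : realType) (alpha : R).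
Hypothesis halpha : 0 < alpha <= 1.

Definition npow (n : nat) : R := n%:R `^ alpha.

Let alpha_gt0 : 0 < alpha. Proof. by case/andP: halpha. Qed.

Lemma npow0 : npow 0 = 0.
Proof. by rewrite /npow powR0// gt_eqF. Qed.

Lemma npow_ge0 n : 0 <= npow n.
Proof. exact: powR_ge0. Qed.

Lemma npow_gt0 n : (0 < n)%N -> 0 < npow n.
Proof. by move=> n0; rewrite powR_gt0// ltr0n. Qed.

Lemma ler_npow m n : (m <= n)%N -> npow m <= npow n.
Proof. by move=> mn; apply: ge0_ler_powR; rewrite ?nnegrE ?ler_nat// ltW. Qed.

Lemma npow_ge1 n : (0 < n)%N -> 1 <= npow n.
Proof.
by move=> /ler_npow; apply: le_trans; rewrite /npow powR1.
Qed.

Lemma npowM m n : npow (m * n) = npow m * npow n.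
Proof. by rewrite /npow natrM powRM. Qed.

(** A ratio in [0, 1] is at most its power of exponent [alpha <= 1]; applied to [m / (m + n)] and
    [n / (m + n)], whose sum is 1. *)
Lemma npowD m n : npow (m + n) <= npow m + npow n.
Proof.
have [->|m0] := posnP m; first by rewrite add0n npow0 add0r.
have s0 : 0 < (m + n)%:R :> R by rewrite ltr0n addn_gt0 m0.
have h k : (k <= m + n)%N -> k%:R / (m + n)%:R * npow (m + n) <= npow k.
  move=> kmn; have [->|k0] := posnP k; first by rewrite !mul0r npow_ge0.
  have t01 : 0 < (k%:R / (m + n)%:R : R) <= 1.
    by apply/andP; split; [rewrite divr_gt0// ltr0n|rewrite ler_pdivrMr// mul1r ler_nat].
  have a1 : alpha <= 1 by case/andP: halpha.
  have := ler_wpM2r (npow_ge0 (m + n)) (ger1_powR t01 a1).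
  rewrite /npow -powRM ?divr_ge0//.
  by rewrite divfK// gt_eqF.
apply: le_trans (lerD (h m (leq_addr _ _)) (h n (leq_addl _ _))).
by rewrite -mulrDl -mulrDl -natrD mulfV ?mul1r// gt_eqF.
Qed.

Lemma npow_shift n j : 0 <= npow (n + j) - npow j <= npow n.
Proof. by rewrite subr_ge0 ler_npow ?leq_addl//= lerBlDr npowD. Qed.

(** With [alpha * N >= 2], the inequality [(t / N) ^ N <= expR t] bounds the terms by a multiple of
    the inverse squares, whose tails are small. *)
Lemma npow_decay (C c eta : R) : 0 <= C -> 0 < c -> 0 < eta ->
  exists Q, forall q, (Q <= q)%N -> forall r,
    \sum_(q <= l < r) C * expR (- (c * npow l)) <= eta.
Proof.
move=> C0 c0 eta0.
have [N N0 HN] : exists2 N : nat, (0 < N)%N & 2 <= alpha * N%:R.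
  exists (Num.bound (2 / alpha)).+1 => //; rewrite mulrC -ler_pdivrMr//.
  apply/ltW/(lt_trans (archi_boundP _)); first by rewrite divr_ge0// ltW.
  by rewrite ltr_nat.
pose D := C * (N%:R / c) ^+ N.
have D0 : 0 <= D by rewrite mulr_ge0// exprn_ge0// divr_ge0// ltW.
have bd l : (0 < l)%N -> C * expR (- (c * npow l)) <= D / l%:R ^+ 2.
  move=> l0; rewrite -mulrA ler_wpM2l// expRN.
  have l2 : l%:R ^+ 2 <= npow l ^+ N.
    rewrite -!powR_mulrn ?npow_ge0// -powRrM.
    by apply: ler_powR => //; rewrite ler1n.
  have x0 : 0 < c * npow l by rewrite mulr_gt0// npow_gt0.
  have eN : (c * npow l / N%:R) ^+ N <= expR (c * npow l).
    have {2}-> : c * npow l = (c * npow l / N%:R) *+ N.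
      by rewrite -mulr_natr divfK// pnatr_eq0 -lt0n.
    rewrite -[X in expR X]mulr_natl expRM_natl.
    apply: lerXn2r; rewrite ?nnegrE ?expR_ge0 ?divr_ge0 ?(ltW x0)//.
    by apply: le_trans (expR_ge1Dx _); rewrite lerDr.
  have y0 : 0 < (c * npow l / N%:R) ^+ N by rewrite exprn_gt0// divr_gt0// ltr0n.
  apply: (@le_trans _ _ ((c * npow l / N%:R) ^+ N)^-1).
    by rewrite lef_pV2 ?posrE// expR_gt0.
  rewrite -[leLHS]exprVn.
  have -> : (c * npow l / N%:R)^-1 = N%:R / c * (npow l)^-1.
    have := npow_gt0 l0; have : 0 < N%:R :> R by rewrite ltr0n.
    move: (npow l) (N%:R) => u v v0 u0; field.
    by do ?[apply/andP; split]; rewrite gt_eqF.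
  rewrite exprMn exprVn ler_wpM2l//; first by rewrite exprn_ge0// divr_ge0// ltW.
  by rewrite lef_pV2// posrE exprn_gt0 ?npow_gt0// ltr0n.
have [Q HQ] : exists Q : nat, 2 * D / eta <= Q%:R.
  exists (Num.bound (2 * D / eta)); apply/ltW/archi_boundP.
  by apply: divr_ge0; [exact: mulr_ge0|exact: ltW].
exists Q.+1 => q Qq r.
have q0 : (0 < q)%N by apply: leq_trans Qq.
(* Telescoping: for [l >= 1] the inverse square of [l] is at most [2 / l - 2 / (l + 1)]. *)
have tele k : \sum_(q <= l < q + k) (l%:R ^+ 2)^-1 <= 2 / q%:R - 2 / (q + k)%:R :> R.
  elim: k => [|k IH]; first by rewrite addn0 big_geq// subrr.
  rewrite addnS big_nat_recr ?leq_addr//=; apply: le_trans (lerD IH (lexx _)) _.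
  have : 1 <= (q + k)%:R :> R by rewrite ler1n addn_gt0 q0.
  rewrite -(natr1 (q + k)); move: (q + k)%:R => s s1.
  rewrite -addrA lerD2l -subr_ge0.
  have -> : - (2 / (s + 1)) - (- (2 / s) + (s ^+ 2)^-1) = (s - 1) / (s ^+ 2 * (s + 1)).
    by field; apply/andP; split; lra.
  by rewrite divr_ge0 ?mulr_ge0 ?exprn_ge0//; lra.
apply: (@le_trans _ _ (\sum_(q <= l < q + r) C * expR (- (c * npow l)))).
  have [rq|qr] := leqP r q.
    rewrite big_geq//; apply: sumr_ge0 => *; exact: mulr_ge0 (expR_ge0 _).
  rewrite [leRHS](big_cat_nat (ltnW qr) (leq_addl q r))//= lerDl.
  by apply: sumr_ge0 => *; exact: mulr_ge0 (expR_ge0 _).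
apply: (@le_trans _ _ (D * \sum_(q <= l < q + r) (l%:R ^+ 2)^-1)).
  rewrite mulr_sumr; apply: ler_sum_nat => l /andP[ql _]; apply: bd.
  exact: leq_trans ql.
apply: (@le_trans _ _ (D * (2 / q%:R))).
  apply: ler_wpM2l => //; apply: le_trans (tele r) _.
  by rewrite gerBl divr_ge0.
rewrite mulrA ler_pdivrMr ?ltr0n// mulrC -ler_pdivrMl// mulrC (mulrC D).
by rewrite [leLHS]mulrC; apply: (le_trans HQ); rewrite ler_nat ltnW.
Qed.
End Powers.

(** The product of the weights of index [j + 1] to [n + j] is a quotient of two of the prescribed
    products. The prescription extends to the empty product because [npow alpha 0] is 0. *)
Lemma iter_weighted_shift (R : realType) (alpha a : R) (w : nat -> R) (x : cseq R) n j :
  0 < alpha ->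
  (forall n, (1 <= n)%N -> \prod_(1 <= k < n.+1) w k = expR (a * npow alpha n)) ->
  iter n (weighted_shift w) x j =
    (expR (a * (npow alpha (n + j) - npow alpha j)))%:C%C * x (n + j)%N.
Proof.
move=> a0 hw.
have hw' k : \prod_(1 <= i < k.+1) w i = expR (a * npow alpha k).
  case: k => [|k]; last exact: hw.
  by rewrite big_geq// /npow powR0 ?gt_eqF// mulr0 expR0.
elim: n j => [|n IH] j; first by rewrite subrr mulr0 expR0 mul1r.
rewrite iterS /weighted_shift IH mulrA addnS addSn; congr (_ * _).
rewrite -rmorphM/=; congr (_%:C)%C.
have /eqP := hw' j.+1; rewrite big_nat_recr//= hw' => /eqP E.
apply: (mulfI (lt0r_neq0 (expR_gt0 (a * npow alpha j)))).
by rewrite mulrA E -!expRD; congr expR; ring.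
Qed.

(** * Blocks *)

(** The factor picked up when [n] shifts carry coordinate [n + j] to coordinate [j]. *)
Definition gain (R : realType) (alpha a : R) (n j : nat) : R :=
  expR (a * (npow alpha (n + j) - npow alpha j)).

Lemma gain_gt0 (R : realType) (alpha a : R) n j : 0 < gain alpha a n j.
Proof. exact: expR_gt0. Qed.

(* Coordinates of [B^n (Y^(m+1)) - v] and of [B^n (|Y|^(m+2))]: since a polynomial
   without terms of degree below [m+1] is [c z^(m+1)] up to [O(|z|^(m+2))], these
   two quantities control the orbit of [P Y] for every such polynomial [P]. *)
Definition resid (R : realType) (alpha : R) (m : nat) (v : cseq R) (a : R)
    (n : nat) (Y : cseq R) (j : nat) : R :=
  cmod ((gain alpha a n j)%:C%C * Y (n + j)%N ^+ m.+1 - v j) +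
  gain alpha a n j * cmod (Y (n + j)%N) ^+ m.+2.

(** Modulus of the [j]-th coordinate of [B^n x - e_0], for the shift of parameter [a]. *)
Definition e0_dist (R : realType) (alpha : R) (x : cseq R) (a : R) (n j : nat) : R :=
  cmod ((gain alpha a n j)%:C%C * x (n + j)%N - (j == 0%N)%:R).

Lemma e0_dist_ge0 (R : realType) (alpha : R) (x : cseq R) (a : R) (n j : nat) :
  0 <= e0_dist alpha x a n j.
Proof. exact: cmod_ge0. Qed.

Section Block.
Variables (R : realType) (alpha : R) (X : normed_subspace R (cseq R)).
Hypotheses (halpha : 0 < alpha <= 1) (hX : lp_or_c0 X).

Local Notation npow := (npow alpha).

Local Notation gain := (gain alpha).

Variables (x : cseq R) (F : pred nat) (A : nat -> R) (r eps : R).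
Variables (m q L0 : nat) (v rho : cseq R) (V : R).
Hypothesis F_gt0 : forall n, F n -> (0 < n)%N.
Hypothesis r_gt0 : 0 < r.
Hypothesis A_bnd : forall n, F n -> r^-1 <= A n <= r.
Hypothesis eps_le : eps <= 2^-1.
Hypothesis orb_le : forall n, F n -> norm_le X (e0_dist alpha x (A n) n) eps.
Hypothesis q_gt0 : (0 < q)%N.
Hypothesis L0q : (L0 <= q)%N.
Hypothesis rhoE : forall j, rho j ^+ m.+1 = v j.
Hypothesis v_le : forall j, cmod (v j) <= V.
Hypothesis v_supp : forall j, (L0 <= j)%N -> v j = 0.

(* The block attached to [n] starts at [q * n]. Since [npow] is multiplicative, this
   dilation keeps the hypotheses: a parameter within [kappa / npow n] of [A n] is
   within [kappa * npow q / npow (q * n)] of it. *)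
Definition block (l : nat) : R[i] :=
  if F (l %/ q)%N && (l %% q < L0)%N then
    (expR (- (A (l %/ q)%N * (npow l - npow (l %% q)%N) / m.+1%:R)))%:C%C *
      rho (l %% q)%N
  else 0.

Let V_ge0 : 0 <= V. Proof. exact: le_trans (cmod_ge0 _) (v_le 0). Qed.

Lemma block_pow l : block l ^+ m.+1 =
  if F (l %/ q)%N && (l %% q < L0)%N then
    (expR (- (A (l %/ q)%N * (npow l - npow (l %% q)%N))))%:C%C * v (l %% q)%N
  else 0.
Proof.
rewrite /block; case: ifP => _; last by rewrite expr0n.
rewrite exprMn rhoE -rmorphXn/= -expRM_natl; congr ((expR _)%:C%C * _).
by rewrite mulrN mulrC divfK// pnatr_eq0.
Qed.

Lemma block_lt l : (l < q)%N -> block l = 0.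
Proof.
move=> lq; rewrite /block divn_small//; case: ifP => // /andP[/F_gt0].
by [].
Qed.

Lemma block_ge n0 l : (forall n, F n -> (n < n0)%N) -> (q * n0 <= l)%N -> block l = 0.
Proof.
move=> Fn ql; rewrite /block; case: ifP => // /andP[/Fn].
by rewrite ltn_divLR// ltnNge mulnC ql.
Qed.

(** The bound is summable in [l] and involves neither [F], [A] nor [eps]. Hence [q] can be taken
    large enough to make the blocks small before [eps], and with it [F], is chosen. *)
Lemma block_le l : cmod (block l) <=
  (1 + V) * expR (r * npow L0) * expR (- ((r * m.+1%:R)^-1 * npow l)).
Proof.
have V1 : 0 <= 1 + V by apply: addr_ge0.
have m0 : 0 < m.+1%:R :> R by rewrite ltr0n.
rewrite /block; case: ifP => [/andP[Fl iL]|_]; last first.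
  by rewrite cmod0 !mulr_ge0// expR_ge0.
rewrite cmodM cmod_real ger0_norm ?expR_ge0// mulrC -[leRHS]mulrA.
apply: ler_pM; rewrite ?cmod_ge0 ?expR_ge0//.
  have [rho1|rho1] := leP (cmod (rho (l %% q)%N)) 1; first by rewrite ler_wpDr.
  apply: (@le_trans _ _ V); last by rewrite lerDr.
  apply: le_trans (v_le (l %% q)); rewrite -rhoE cmodX.
  by rewrite -[leLHS]expr1 ler_weXn2l// ltW.
rewrite -?expRD ler_expR; have /andP[A1 A2] := A_bnd Fl.
set n := (l %/ q)%N in A1 A2 *; set i := (l %% q)%N in iL *.
have iq : npow i <= npow L0 by apply: (ler_npow halpha); exact: ltnW.
have l0 := npow_ge0 alpha l; have i0 := npow_ge0 alpha i.
rewrite invfM; have m1 : m.+1%:R^-1 <= 1 :> R by rewrite invf_le1// ler1n.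
have mV : 0 <= m.+1%:R^-1 :> R by rewrite invr_ge0 ltW.
have rV : 0 < r^-1 by rewrite invr_gt0.
have h1 : A n * npow i <= r * npow L0 by apply: ler_pM => //; lra.
have h2 : r^-1 * npow l <= A n * npow l by apply: ler_wpM2r.
have h3 : 0 <= r * npow L0 by apply: mulr_ge0; [exact: ltW|exact: npow_ge0].
have h4 : A n * npow i * m.+1%:R^-1 <= r * npow L0 * 1.
  by apply: ler_pM => //; apply: mulr_ge0 => //; lra.
have := ler_wpM2l mV h2; move: h4; move: (_^-1) (m.+1%:R^-1) => ? ?; lra.
Qed.

(** * The orbit of the blocks at the dilated time *)

Section Orbit.
Variables (n : nat) (a kappa : R).
Hypothesis Fn : F n.
Hypothesis a_near : `|a - A n| <= kappa / npow n.
Hypothesis kappa_le : kappa * npow q <= 2^-1.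

Let nq := (q * n)%N.

(** The increment of [npow] is at most [npow (q * n) = npow q * npow n], and [npow n] cancels
    against the closeness of [a] to [A n]. *)
Let near_gain j : `|(a - A n) * (npow (nq + j) - npow j)| <= kappa * npow q.
Proof.
have n0 : 0 < npow n by apply: npow_gt0 => //; exact: F_gt0.
rewrite normrM; have /andP[s0 s1] := npow_shift halpha nq j.
rewrite (ger0_norm s0); apply: le_trans (ler_pM _ s0 a_near s1) _ => //.
rewrite /nq npowM; have -> : kappa / npow n * (npow q * npow n) = kappa * npow q.
  by field; rewrite gt_eqF.
by [].
Qed.

(** For [j < q] the index [nq + j] lies in the block of [n] with remainder [j], so the gain for
    [A n] cancels exactly. What remains is [v j] times a factor close to 1, because [a] is close to
    [A n]. *)
Lemma block_head j : (j < q)%N ->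
  cmod ((gain a nq j)%:C%C * block (nq + j) ^+ m.+1 - v j) <=
    (if (j < L0)%N then V * (2 * (kappa * npow q)) else 0).
Proof.
move=> jq; rewrite block_pow /nq mulnC divnMDl// divn_small// addn0 modnMDl.
rewrite modn_small// Fn/=; case: ltnP => jL; last first.
  by rewrite v_supp// mulr0 subrr cmod0.
rewrite mulrA -rmorphM/= -expRD mulnC -/nq.
have -> : a * (npow (nq + j) - npow j) - A n * (npow (nq + j) - npow j) =
  (a - A n) * (npow (nq + j) - npow j) by ring.
set t := (a - A n) * _; have -> : (expR t)%:C%C * v j - v j = (expR t - 1)%:C%C * v j.
  by rewrite rmorphB/= mulrBl mul1r.
rewrite cmodM cmod_real mulrC ler_pM ?cmod_ge0//.
by apply: expR_dist1 => //; exact: near_gain.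
Qed.

Lemma block_head_pow j : (j < q)%N ->
  gain a nq j * cmod (block (nq + j)) ^+ m.+1 <= (if (j < L0)%N then 2 * V else 0).
Proof.
move=> jq; rewrite -cmodX.
have -> : gain a nq j * cmod (block (nq + j) ^+ m.+1) =
  cmod ((gain a nq j)%:C%C * block (nq + j) ^+ m.+1).
  by rewrite cmodM cmod_real ger0_norm// expR_ge0.
have := block_head jq; case: ltnP => jL H; last first.
  by move: H; rewrite v_supp// subr0.
set u := _ * _ in H *; rewrite -(subrK (v j) u); apply: le_trans (cmodD _ _) _.
have := v_le j; have := V_ge0; move: H; rewrite -/u.
have kq : 2 * (kappa * npow q) <= 1 by rewrite mulrC -ler_pdivlMr// mul1r.
have := ler_wpM2l V_ge0 kq.
lra.
Qed.

(* The block of a later index [n + J], seen from [q * n], has size about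
   [expR (- npow q * E)], while the [J]-th coordinate of the original orbit at time [n]
   is about [expR (- E)] and at most [eps < 1]: hence [E >= 0], and the dilated value
   is no larger than the original one. *)
Lemma block_later j : (q <= j)%N ->
  gain a nq j * cmod (block (nq + j)) ^+ m.+1 <=
    4 * V * expR (2 * r * npow q) * e0_dist alpha x (A n) n (j %/ q).
Proof.
move=> qj; have rhs0 : 0 <= 4 * V * expR (2 * r * npow q) * e0_dist alpha x (A n) n (j %/ q).
  by rewrite !mulr_ge0 ?expR_ge0 ?e0_dist_ge0.
rewrite -cmodX block_pow /nq mulnC divnMDl// modnMDl.
case: ifP => [/andP[Fn' iL]|_]; last by rewrite cmod0 mulr0.
move: iL Fn'; set i := (j %% q)%N; set J := (j %/ q)%N => iL Fn'.
have J0 : (0 < J)%N by rewrite divn_gt0.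
have jE : j = (q * J + i)%N by rewrite mulnC -divn_eq.
rewrite cmodM cmod_real ger0_norm ?expR_ge0// mulrA -expRD.
set T := _ - _.
have iq : npow i <= npow q by apply: (ler_npow halpha); exact: ltnW (ltn_pmod _ _).
have i0 := npow_ge0 alpha i.
have q1 := npow_ge1 halpha q_gt0.
have /andP[A1 A2] := A_bnd Fn; have /andP[A'1 A'2] := A_bnd Fn'.
have rV : 0 < r^-1 by rewrite invr_gt0.
pose E := A (n + J)%N * npow (n + J) - A n * (npow (n + J) - npow J).
(* Replacing [a] by [A n] costs [kappa * npow q]. Neglecting the remainder [i] of [j] modulo [q]
   costs at most [r * npow q] for each of the parameters [A n] and [A (n + J)]. The rest is
   homogeneous in [npow q]. *)
have TE : T <= kappa * npow q + 2 * r * npow q - npow q * E.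
  have lE : (n * q + j = q * (n + J) + i)%N by rewrite jE mulnDr mulnC addnA.
  have := near_gain j; rewrite ler_norml => /andP[_ g1].
  rewrite /T; move: g1; rewrite /nq [(q * n)%N]mulnC lE.
  have l1 := npowD halpha (q * (n + J)) i.
  have l2 := ler_npow halpha (leq_addr i (q * (n + J))).
  have j1 : npow (q * J) <= npow j by apply: (ler_npow halpha); rewrite jE leq_addr.
  move: l1 l2 j1; rewrite /E !npowM.
  move: (npow (q * (n + J) + i)) (npow j) (npow i) (npow q) (npow (n + J)) (npow J) iq i0 q1
    => pl pj pi pq pn' pJ iq i0 q1 l1 l2 j1 g1.
  have h1 : A n * (pl - pj) <= A n * (pq * pn' - pq * pJ) + r * pq.
    apply: (@le_trans _ _ (A n * (pq * pn' - pq * pJ + pq))).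
      by apply: ler_wpM2l; lra.
    by rewrite mulrDr lerD2l ler_wpM2r//; lra.
  have h2 : A (n + J)%N * (pq * pn' - pl + pi) <= r * pq.
    by apply: ler_pM => //; lra.
  lra.
(* Coordinate 0 of the orbit at time [n + J], for the parameter [A (n + J)], is within [eps <= 1/2]
   of 1, hence has modulus at least 1/2. *)
have x2 : expR (- (A (n + J)%N * npow (n + J))) <= 2 * cmod (x (n + J)%N).
  have := norm_le_coord hX 0 (orb_le Fn').
  rewrite ger0_norm ?e0_dist_ge0// /e0_dist addn0 /gain addn0 npow0// subr0 eqxx.
  rewrite cmodC => h0; set P := expR _ in h0; have P0 : 0 < P := expR_gt0 _.
  have : 1 <= eps + P * cmod (x (n + J)%N).
    rewrite -(cmod1 R) -[X in cmod X](subrK (P%:C%C * x (n + J)%N)).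
    apply: le_trans (cmodD _ _) _; rewrite cmodM cmod_real (ger0_norm (ltW P0)).
    exact: lerD.
  by rewrite expRN -/P -div1r ler_pdivrMr//; have := eps_le; move: (cmod _) => c; lra.
have orbE : e0_dist alpha x (A n) n J = expR (A n * (npow (n + J) - npow J)) * cmod (x (n + J)%N).
  by rewrite /e0_dist eqn0Ngt J0 subr0 cmodM cmod_real ger0_norm// expR_ge0.
have E2 : expR (- E) <= 2 * e0_dist alpha x (A n) n J.
  rewrite orbE /E opprB expRD mulrCA ler_wpM2l ?expR_ge0//.
have orbJ := norm_le_coord hX J (orb_le Fn).
rewrite ger0_norm ?e0_dist_ge0// in orbJ.
have E0 : 0 <= E.
  by rewrite -oppr_le0 -expR_le1; apply: le_trans E2 _; have := eps_le; lra.
apply: (@le_trans _ _ ((2 * expR (2 * r * npow q) * (2 * e0_dist alpha x (A n) n J)) * V)).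
  apply: ler_pM; rewrite ?expR_ge0 ?cmod_ge0//.
  apply: (@le_trans _ _ (expR (kappa * npow q + 2 * r * npow q - E))).
    rewrite ler_expR; apply: le_trans TE _; rewrite lerD2l lerN2.
    by rewrite ler_peMl.
  rewrite !expRD; apply: ler_pM; rewrite ?mulr_ge0 ?expR_ge0//.
  rewrite ler_wpM2r ?expR_ge0//.
  have : `|expR (kappa * npow q) - 1| <= 2 * 2^-1.
    apply: expR_dist1 => //; rewrite ger0_norm//.
    by apply: le_trans (near_gain 0).
  by rewrite ler_norml => /andP[_]; lra.
rewrite le_eqVlt; apply/orP; left; apply/eqP; ring.
Qed.

(** Three ranges of [j]: below [q] sits the block of [n] itself ([g1]); then come the later blocks
    ([g2]), controlled by the stretched orbit of [x]; from index [M] on only the sum of [Y] is known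
    ([g3]), and the gain is at most [expR (r * npow M)]. The bound [eta] on the entries makes the
    extra power in [resid] small. *)
Lemma resid_block_le (Y : cseq R) (M : nat) (eta eta' : R) :
  0 <= a <= r -> (forall l, cmod (Y l) <= 1) ->
  (forall k, F k -> (q * k.+1 <= M)%N) ->
  (forall l, (q <= l < M)%N -> Y l = block l) ->
  (forall l, cmod (block l) <= eta) ->
  (forall N, \sum_(M <= l < N) cmod (Y l) <= eta') ->
  norm_le X (resid alpha m v a nq Y)
    (L0%:R * (V * (2 * (kappa * npow q)) + 2 * V * eta) +
     8 * V * expR (2 * r * npow q) * (q%:R * eps) +
     2 * expR (r * npow M) * eta').
Proof.
move=> /andP[a0 ar] Y1 FM Yblock block_eta Ytail.
have nq_ge : (q <= nq)%N by rewrite leq_pmulr// F_gt0.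
have eta0 : 0 <= eta by apply: le_trans (block_eta 0); exact: cmod_ge0.
have c0 : 0 <= V * (2 * (kappa * npow q)) + 2 * V * eta.
  rewrite addr_ge0// mulr_ge0// mulr_ge0//.
  by apply: le_trans (near_gain 0).
have g0 j := gain_gt0 alpha a nq j.
pose g1 j := if (j < L0)%N then V * (2 * (kappa * npow q)) + 2 * V * eta else 0.
pose g2 j := 8 * V * expR (2 * r * npow q) * e0_dist alpha x (A n) n (j %/ q).
pose g3 j := 2 * expR (r * npow M) * (if (M <= nq + j)%N then cmod (Y (nq + j)%N) else 0).
have g1_ge0 j : 0 <= g1 j by rewrite /g1; case: ifP.
have g2_ge0 j : 0 <= g2 j by rewrite /g2 !mulr_ge0 ?expR_ge0 ?e0_dist_ge0.
have g3_ge0 j : 0 <= g3 j.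
  by rewrite /g3 !mulr_ge0 ?expR_ge0//; case: ifP => // _; exact: cmod_ge0.
apply: (@norm_le_mono _ _ hX _ (fun j => g1 j + g2 j + g3 j)).
  move=> j; apply/andP; split.
    by rewrite addr_ge0 ?cmod_ge0// mulr_ge0 ?exprn_ge0 ?cmod_ge0// ltW.
  have powS : gain a nq j * cmod (Y (nq + j)%N) ^+ m.+2 =
      gain a nq j * cmod (Y (nq + j)%N) ^+ m.+1 * cmod (Y (nq + j)%N).
    by rewrite exprSr mulrA.
  have pow0 : 0 <= gain a nq j * cmod (Y (nq + j)%N) ^+ m.+1.
    by rewrite mulr_ge0 ?exprn_ge0 ?cmod_ge0// ltW.
  have pow1 : gain a nq j * cmod (Y (nq + j)%N) ^+ m.+2 <=
      gain a nq j * cmod (Y (nq + j)%N) ^+ m.+1.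
    by rewrite powS ler_piMr.
  have [jq|qj] := ltnP j q.
    have Mj : (nq + j < M)%N.
      by apply: leq_trans (FM _ Fn); rewrite mulnS addnC ltn_add2r.
    have YE : Y (nq + j)%N = block (nq + j).
      by apply: Yblock; rewrite Mj andbT (leq_trans nq_ge)// leq_addr.
    apply: (@le_trans _ _ (g1 j)); last by rewrite -addrA lerDl addr_ge0.
    rewrite /resid powS YE; have := block_head jq; have := block_head_pow jq.
    rewrite /g1; case: ltnP => jL h1 h2.
      apply: lerD => //; apply: ler_pM => //; [by rewrite -YE|exact: cmod_ge0].
    rewrite -[leRHS]addr0; apply: lerD => //.
    apply: le_trans (ler_wpM2l _ (block_eta _)) _; first by rewrite -YE.
    by rewrite -(mul0r eta) ler_wpM2r.
  (* Here [v j] vanishes, and [cmod (Y l) <= 1] lets the higher power be absorbed by the lower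
     one. *)
  have residE : resid alpha m v a nq Y j <=
      2 * (gain a nq j * cmod (Y (nq + j)%N) ^+ m.+1).
    rewrite /resid v_supp ?(leq_trans L0q)// subr0 cmodM cmod_real cmodX.
    by rewrite (ger0_norm (ltW (g0 j))); lra.
  apply: (le_trans residE); have [Mj|jM] := leqP M (nq + j)%N.
    apply: (@le_trans _ _ (g3 j)); last by rewrite lerDr addr_ge0.
    rewrite /g3 Mj -mulrA ler_wpM2l//.
    apply: ler_pM; rewrite ?exprn_ge0 ?cmod_ge0 ?(ltW (g0 j))//.
      rewrite ler_expR; have /andP[s0 s1] := npow_shift halpha nq j.
      apply: ler_pM => //; apply: (le_trans s1); apply: ler_npow => //.
      by apply: leq_trans (FM _ Fn); rewrite leq_mul2l ltnW ?orbT.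
    by rewrite exprS ler_piMr ?cmod_ge0// exprn_ile1// cmod_ge0.
  apply: (@le_trans _ _ (g2 j)); last by rewrite -addrA [leRHS]addrCA lerDl addr_ge0.
  rewrite Yblock ?jM ?andbT ?(leq_trans nq_ge) ?leq_addr//.
  have := block_later qj; rewrite /g2; lra.
apply: norm_leD => //; [by move=> j; rewrite addr_ge0| |].
- apply: norm_leD => //.
    apply: norm_le_l1 => // N.
    apply: (@le_trans _ _ (\sum_(0 <= j < L0 + N) g1 j)).
      by rewrite [leRHS](big_cat_nat (leq0n N) (leq_addl _ _))//= lerDl sumr_ge0.
    rewrite (big_cat_nat (leq0n L0) (leq_addr _ _))//= [X in _ + X]big_nat.
    rewrite [X in _ + X]big1 ?addr0; last first.
      by move=> j /andP[Lj _]; rewrite /g1 ltnNge Lj.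
    rewrite (eq_big_nat _ _ (F2 := fun=> V * (2 * (kappa * npow q)) + 2 * V * eta)).
      by rewrite sumr_const_nat subn0 [leRHS]mulr_natl.
    by move=> j /andP[_ jL]; rewrite /g1 jL.
  apply: norm_leZ => //; first by rewrite !mulr_ge0 ?expR_ge0.
  by apply: (@norm_le_stretch _ _ hX q (e0_dist alpha x (A n) n)) => //; exact: orb_le.
- apply: norm_leZ => //.
  apply: norm_le_l1 => // [j|N]; first by case: ifP => // _; exact: cmod_ge0.
  apply: le_trans (Ytail (N + nq)%N).
  pose h l := if (M <= l)%N then cmod (Y l) else 0.
  have h0 l : 0 <= h l by rewrite /h; case: ifP => // _; exact: cmod_ge0.
  rewrite (eq_bigr (fun i => h (i + nq)%N)); last by move=> i _; rewrite addnC.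
  have -> : \sum_(0 <= i < N) h (i + nq)%N = \sum_(nq <= i < N + nq) h i.
    by rewrite -{2}[nq]add0n big_addn addnK.
  have nqM : (nq <= M)%N.
    by apply: leq_trans (FM _ Fn); rewrite leq_mul2l leqnSn orbT.
  have [MN|NM] := leqP M (N + nq).
    rewrite (big_cat_nat nqM MN)//= big_nat big1 ?add0r.
      by apply: ler_sum_nat => l /andP[Ml _]; rewrite /h Ml.
    by move=> l /andP[_ lM]; rewrite /h leqNgt lM.
  rewrite [leRHS]big_geq 1?ltnW// big_nat big1// => l /andP[_ lN].
  by rewrite /h leqNgt (ltn_trans lN NM).
Qed.
End Orbit.
End Block.

(** * What a hypercyclic vector provides *)

(** The quotient [expR (s - t)] is at most [(1 + eps) / (1 - eps)], which is at most [1 + 4 * eps]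
    when [eps <= 1/2]; and [1 + (s - t)] is at most this exponential. *)
Lemma expR_mul_near1 (R : realType) (s t eps : R) (z : R[i]) : eps <= 2^-1 ->
  cmod ((expR s)%:C%C * z - 1) <= eps -> cmod ((expR t)%:C%C * z - 1) <= eps ->
  s - t <= 4 * eps.
Proof.
move=> e2 hs ht.
have s1 : expR s * cmod z <= 1 + eps.
  rewrite -[expR s]ger0_norm ?expR_ge0// -cmod_real -cmodM.
  rewrite -[X in cmod X](subrK 1) addrC; apply: le_trans (cmodD _ _) _.
  by rewrite cmod1 lerD2l.
have t1 : 1 <= expR t * cmod z + eps.
  rewrite -[expR t]ger0_norm ?expR_ge0// -cmod_real -cmodM.
  rewrite -(cmod1 R) -[X in cmod X <= _](subKr ((expR t)%:C%C * z)).
  by apply: le_trans (cmodB _ _) _; rewrite lerD2l.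
have e0 : 0 <= eps by apply: le_trans hs; exact: cmod_ge0.
have st : expR s = expR (s - t) * expR t by rewrite -expRD subrK.
rewrite -ler_expR; apply: le_trans (expR_ge1Dx _).
have p0 := expR_gt0 (s - t).
move: s1; rewrite st -mulrA; move: t1; move: (expR t * cmod z) (expR (s - t)) p0.
by move=> p u u0 t1 s1; nra.
Qed.

Lemma iter_product_map (V : Type) (S T : V -> V) n z :
  iter n (product_map S T) z = (iter n S z.1, iter n T z.2).
Proof. by elim: n => [|n IH]; [case: z|rewrite iterS IH]. Qed.

(** * Covering compact parameter sets by hitting times *)

Section Cover.
Variables (R : realType) (alpha : R) (X : normed_subspace R (cseq R)).
Hypotheses (halpha : 0 < alpha <= 1) (hX : lp_or_c0 X).
Local Notation npow := (npow alpha).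
Local Notation gain := (gain alpha).

Local Notation e0_dist := (e0_dist alpha).

(** Coordinate 0 shows that all parameters served by the same time [n] lie within [4 * eps / npow n]
    of each other, so one representative for each [n] is enough, and compactness leaves finitely
    many [n]. *)
Lemma compact_e0_cover (x y : cseq R) (K : set (R * R)) (eps : R) :
  compact K -> 0 < eps <= 2^-1 ->
  (forall c, K c -> exists2 n, (1 <= n)%N &
     norm_le X (e0_dist x c.1 n) eps /\ norm_le X (e0_dist y c.2 n) eps) ->
  exists (F : pred nat) (N : nat) (A B : nat -> R),
  [/\ forall n, F n -> (0 < n < N)%N,
      forall n, F n -> K (A n, B n),
      forall n, F n -> norm_le X (e0_dist x (A n) n) eps /\
                       norm_le X (e0_dist y (B n) n) eps &
      forall c, K c -> exists2 n, F n &
        `|c.1 - A n| <= 5 * eps / npow n /\ `|c.2 - B n| <= 5 * eps / npow n].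
Proof.
move=> Kc /andP[eps0 eps2] hK.
pose P n := [set c | [/\ K c, (1 <= n)%N, norm_le X (e0_dist x c.1 n) eps &
                      norm_le X (e0_dist y c.2 n) eps]].
(* The default value is taken only when no parameter is served by [n]; such times are discarded
   through [S]. *)
pose rep n : R * R := xget (0, 0) (P n).
have repP n c : P n c -> P n (rep n) by move=> Pc; exact: (xgetI (0, 0) Pc).
(* The radius exceeds [4 * eps / npow n], so that this open ball contains every parameter served by
   [n]. *)
pose U n := ball (rep n) (5 * eps / npow n).
have near n c : P n c -> U n c.
  move=> Pc; have [_ n1 rx ry] := repP _ _ Pc; case: Pc => _ _ cx cy.
  have n0 : 0 < npow n by exact: npow_gt0.
  have H z (s t : R) : norm_le X (e0_dist z s n) eps -> norm_le X (e0_dist z t n) eps ->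
      ball s (5 * eps / npow n) t.
    move=> /(norm_le_coord hX 0) zs /(norm_le_coord hX 0) zt.
    move: zs zt; rewrite !ger0_norm ?e0_dist_ge0// /e0_dist /gain addn0 npow0// !subr0 => zs zt.
    have st := expR_mul_near1 eps2 zs zt; have ts := expR_mul_near1 eps2 zt zs.
    rewrite /ball/= ltr_pdivlMr// -[npow n in ltLHS]gtr0_norm// -normrM mulrBl.
    apply: (@le_lt_trans _ _ (4 * eps)); last by lra.
    by rewrite ler_norml; apply/andP; split; lra.
  by split; [exact: H rx cx|exact: H ry cy].
pose S n := exists c, P n c.
have Uopen n : S n -> open (U n).
  by case=> c [_ n1 _ _]; apply: ball_open; rewrite divr_gt0 ?mulr_gt0// npow_gt0.
(* Compactness is used with the filter of large [N]: the balls of index below a single [N] cover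
   [K]. *)
move/compact_near_coveringP : Kc.
move=> /(_ nat \oo (fun N c => exists2 n, (n < N)%N & S n /\ U n c)).
case.
- move=> c Kc; have [n n1 [cx cy]] := hK c Kc.
  have Pc : P n c by split.
  exists (U n, [set N | (n < N)%N]) => /=; last first.
    by move=> [c' N] /= [Uc' nN]; exists n => //; split=> //; exists c.
  split; last by exists n.+1.
  by apply: open_nbhs_nbhs; split; [apply: Uopen; exists c|exact: near].
move=> N _ /(_ N (leqnn N)) Ncov.
exists (fun n => (n < N)%N && `[< S n >]), N, (fun n => (rep n).1), (fun n => (rep n).2).
have repS n : (n < N)%N && `[< S n >] -> P n (rep n) by case/andP=> _ /asboolP[c]; exact: repP.
split.
- by move=> n Sn; have [_ -> _ _] := repS n Sn; case/andP: Sn.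
- by move=> n /repS[]; rewrite -surjective_pairing.
- by move=> n /repS[].
- move=> c /Ncov[n nN [Sn [c1 c2]]]; exists n; first by rewrite nN; apply/asboolP.
  by rewrite (distrC c.1) (distrC c.2); split; exact: ltW.
Qed.

Variables (wa wb : nat -> R) (a b : R).
Hypothesis hwa : forall n, (1 <= n)%N -> \prod_(1 <= k < n.+1) wa k = expR (a * npow n).
Hypothesis hwb : forall n, (1 <= n)%N -> \prod_(1 <= k < n.+1) wb k = expR (b * npow n).

Let T := product_map (weighted_shift wa) (weighted_shift wb).

Lemma iter_shiftE n z : iter n T z =
  (fun j => (gain a n j)%:C%C * z.1 (n + j)%N, fun j => (gain b n j)%:C%C * z.2 (n + j)%N).
Proof.
have a0 : 0 < alpha by case/andP: halpha.
rewrite iter_product_map; congr pair; apply/funext => j.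
  exact: iter_weighted_shift.
exact: iter_weighted_shift.
Qed.

Lemma HC_orbit (z : cseq R * cseq R) (u1 u2 : cseq R) (e : R) :
  HC (square_space X) T z -> carrier X u1 -> carrier X u2 -> 0 < e ->
  exists2 n, (1 <= n)%N &
    norm_le X (fun j => cmod ((gain a n j)%:C%C * z.1 (n + j)%N - u1 j)) e /\
    norm_le X (fun j => cmod ((gain b n j)%:C%C * z.2 (n + j)%N - u2 j)) e.
Proof.
move=> [_ hz] u1X u2X e0; have [_ [n n1 ->]] := hz (u1, u2) (conj u1X u2X) e e0.
rewrite iter_shiftE /= gt_max => /andP[h1 h2]; exists n => //; split.
  by apply: norm_le_enorm (ltW h1) => // j; rewrite ger0_norm// cmod_ge0.
by apply: norm_le_enorm (ltW h2) => // j; rewrite ger0_norm// cmod_ge0.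
Qed.

Lemma carrier_e0 (c : R) : carrier X (fun j => (c * (j == 0%N)%:R)%:C%C).
Proof.
apply: (@carrier_l1 _ _ hX _ `|c|) => -[|N]; first by rewrite big_geq.
rewrite big_nat_recl// big1 ?addr0; first by rewrite cmod_real eqxx mulr1.
by move=> j _; rewrite cmod_real mulr0 normr0.
Qed.

(** For a parameter that is not positive, the gain at coordinate 0 is at most 1. That coordinate
    then stays bounded by a bound [s] of the vector, and no iterate comes within 1 of
    [(s + 2) e_0]. *)
Lemma HC_param_gt0 (z : cseq R * cseq R) : HC (square_space X) T z -> 0 < a /\ 0 < b.
Proof.
move=> hz; case: (hz) => -[z1X z2X] _.
have [s1 hs1] := carrier_bounded hX z1X; have [s2 hs2] := carrier_bounded hX z2X.
have [n n1 [h1 h2]] :=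
  HC_orbit hz (carrier_e0 (s1 + 2)) (carrier_e0 (s2 + 2)) ltr01.
have H (c s : R) (x : cseq R) : (forall n, cmod (x n) <= s) ->
  norm_le X (fun j => cmod ((gain c n j)%:C%C * x (n + j)%N -
     ((s + 2) * (j == 0%N)%:R)%:C%C)) 1 -> 0 < c.
  move=> xs /(norm_le_coord hX 0); rewrite ger0_norm ?cmod_ge0//.
  rewrite /gain addn0 npow0// subr0 mulr1 => h.
  have s0 : 0 <= s by apply: le_trans (xs 0); exact: cmod_ge0.
  have : s + 2 <= 1 + expR (c * npow n) * s.
    have -> : s + 2 = cmod ((s + 2)%:C%C : R[i]) by rewrite cmod_real ger0_norm// addr_ge0.
    rewrite -[X in cmod X](subrK ((expR (c * npow n))%:C%C * x n)).
    apply: le_trans (cmodD _ _) _; apply: lerD; first by rewrite cmodC.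
    by rewrite cmodM cmod_real ger0_norm ?expR_ge0// ler_wpM2l ?expR_ge0.
  move=> h'; rewrite ltNge; apply/negP => c0.
  have : expR (c * npow n) <= 1.
    by rewrite expR_le1; apply: mulr_le0_ge0 => //; exact: npow_ge0.
  by move=> e1; have := ler_wpM2r s0 e1; lra.
by split; [exact: H hs1 h1|exact: H hs2 h2].
Qed.
End Cover.

(** * Construction of a universal pair *)

Lemma complex_root (R : realType) (m : nat) (z : R[i]) : exists w : R[i], w ^+ m.+1 = z.
Proof. by exists (m.+1.-root z); rewrite rootCK. Qed.

(* Gliding hump: the step [s] fixes the terms of index in [[M, M')] and leaves a
   tolerance [eta'] for the sum of the later ones. *)
Lemma gliding_hump (R : realType) (V : nmodType) (sz : V -> R)
    (G : nat -> (nat -> V) -> Prop) :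
  (forall v, 0 <= sz v) ->
  (forall s M (eta : R), 0 < eta -> exists M' (eta' : R) h,
    [/\ (M < M')%N, 0 < eta', forall l, ~~ (M <= l < M')%N -> h l = 0,
        \sum_(M <= l < M') sz (h l) <= eta &
        forall Y, (forall l, (M <= l < M')%N -> Y l = h l) ->
          (forall N, \sum_(0 <= l < N) sz (Y l) <= 1) ->
          (forall N, \sum_(M' <= l < N) sz (Y l) <= eta') -> G s Y]) ->
  exists Y, (forall N, \sum_(0 <= l < N) sz (Y l) <= 1) /\ forall s, G s Y.
Proof.
move=> sz0 step.
(* The step becomes a total function, with a dummy value when the tolerance is not positive. *)
have /choice[f fP] (p : nat * (nat * R)) : exists o : nat * R * (nat -> V),
    0 < p.2.2 -> let: (M', eta', h) := o in
    [/\ (p.2.1 < M')%N, 0 < eta', forall l, ~~ (p.2.1 <= l < M')%N -> h l = 0,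
        \sum_(p.2.1 <= l < M') sz (h l) <= p.2.2 &
        forall Y, (forall l, (p.2.1 <= l < M')%N -> Y l = h l) ->
          (forall N, \sum_(0 <= l < N) sz (Y l) <= 1) ->
          (forall N, \sum_(M' <= l < N) sz (Y l) <= eta') -> G p.1 Y].
  case: p => s [M eta] /=; have [eta0|eta0] := ltP 0 eta.
    by have [M' [eta' [h H]]] := step s M eta eta0; exists (M', eta', h).
  by exists (0%N, 0, fun=> 0).
(* Halving makes twice the new tolerance at most [eta'], the bound required of everything that
   follows. *)
pose next s (st : nat * R) := let: (M', eta', h) := f (s, st) in
  (M', Num.min eta' st.2 / 2).
(* Starting from 1/2, the total size is at most twice this, that is 1. *)
pose st := fix st s := if s is s'.+1 then next s' (st s') else (0%N, 2^-1 : R).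
pose M s := (st s).1; pose eta s := (st s).2; pose h s := (f (s, st s)).2.
pose eta' s := (f (s, st s)).1.2.
have MS s : (f (s, st s)).1.1 = M s.+1 by rewrite /M /= /next; case: (f _) => -[].
have etaS s : eta s.+1 = Num.min (eta' s) (eta s) / 2.
  by rewrite /eta /eta' /= /next; case: (f _) => -[].
have eta_gt0 s : 0 < eta s.
  elim: s => [|s IH]; first by rewrite /eta /= invr_gt0.
  rewrite etaS divr_gt0// lt_min IH andbT /eta'.
  by have := fP (s, st s) IH; case: (f _) => -[? ?] ? [].
have {}fP s : [/\ (M s < M s.+1)%N, 0 < eta' s,
    forall l, ~~ (M s <= l < M s.+1)%N -> h s l = 0,
    \sum_(M s <= l < M s.+1) sz (h s l) <= eta s &
    forall Y, (forall l, (M s <= l < M s.+1)%N -> Y l = h s l) ->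
      (forall N, \sum_(0 <= l < N) sz (Y l) <= 1) ->
      (forall N, \sum_(M s.+1 <= l < N) sz (Y l) <= eta' s) -> G s Y].
  have := fP (s, st s) (eta_gt0 s); rewrite -MS /eta' /h.
  by case: (f _) => -[? ?] ?.
have Mlt s : (M s < M s.+1)%N by case: (fP s).
have Mmono s t : (s <= t)%N -> (M s <= M t)%N.
  move=> /subnK <-; elim: (t - s)%N => // k IH.
  by apply: leq_trans IH _; rewrite addSn ltnW.
have Mge s : (s <= M s)%N by elim: s => // s IH; exact: leq_ltn_trans (Mlt s).
have hsupp s l : ~~ (M s <= l < M s.+1)%N -> h s l = 0.
  by have [_ _ H _ _] := fP s; exact: H.
(* At most one summand is nonzero, and since [s <= M s] the steps [s > l] do not reach index [l]. *)
pose Y l := \sum_(0 <= s < l.+1) h s l.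
have YE s l : (M s <= l < M s.+1)%N -> Y l = h s l.
  move=> /andP[sl ls].
  rewrite /Y big_mkord (bigD1 (Ordinal (leq_trans (Mge s) sl : (s < l.+1)%N)))//=.
  rewrite big1 ?addr0// => t; rewrite -val_eqE/= => ts; apply: hsupp.
  apply/negP => /andP[tl lt]; case: (ltngtP (t : nat) s) ts => // ts _.
    by have := leq_ltn_trans (leq_trans (Mmono _ _ ts) sl) lt; rewrite ltnn.
  by have := leq_ltn_trans (leq_trans (Mmono _ _ ts) tl) ls; rewrite ltnn.
have Ysum s t : \sum_(M s <= l < M (s + t)%N) sz (Y l) <= 2 * eta s - 2 * eta (s + t)%N.
  elim: t => [|t IH]; first by rewrite addn0 big_geq// subrr.
  rewrite addnS (big_cat_nat (Mmono _ _ (leq_addr t s)) (ltnW (Mlt _)))/=.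
  apply: le_trans (lerD IH (_ : _ <= eta (s + t)%N)) _.
    have [_ _ _ hle _] := fP (s + t)%N; apply: le_trans hle.
    by apply: ler_sum_nat => l lM; rewrite (YE _ _ lM).
  (* Hence each tolerance is at most twice its difference with the next one, and the sum
     telescopes. *)
  have : eta (s + t).+1 <= eta (s + t)%N / 2.
    by rewrite etaS ler_pM2r// ge_min lexx orbT.
  lra.
have Ytail s N : \sum_(M s <= l < N) sz (Y l) <= 2 * eta s.
  have [NM|MN] := leqP N (M s).
    by rewrite big_geq// mulr_ge0// ltW.
  apply: (@le_trans _ _ (\sum_(M s <= l < M (s + N)%N) sz (Y l))).
    have NM : (N <= M (s + N))%N by apply: leq_trans (Mge _); exact: leq_addl.
    by rewrite [leRHS](big_cat_nat (ltnW MN) NM)/= lerDl sumr_ge0.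
  by apply: le_trans (Ysum s N) _; rewrite gerBl mulr_ge0// ltW.
have Y1 N : \sum_(0 <= l < N) sz (Y l) <= 1.
  by have := Ytail 0%N N; rewrite /M /eta /= divff.
exists Y; split=> // s; have [_ _ _ _] := fP s; apply => //; first exact: YE.
move=> N; apply: le_trans (Ytail _ _) _.
by rewrite etaS mulrC divfK// ge_min lexx.
Qed.

(** * One step of the construction *)

Section Stage.
Variables (R : realType) (alpha : R) (X : normed_subspace R (cseq R)).
Hypotheses (halpha : 0 < alpha <= 1) (hX : lp_or_c0 X).
Local Notation npow := (npow alpha).

Definition psize (z : R[i] * R[i]) : R := cmod z.1 + cmod z.2.

Lemma psize_ge0 z : 0 <= psize z.
Proof. by rewrite addr_ge0 ?cmod_ge0. Qed.

Lemma psize0 : psize 0 = 0.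
Proof. exact: etrans (congr2 +%R (cmod0 R) (cmod0 R)) (addr0 0). Qed.

Lemma sum_fst_le (Y : nat -> R[i] * R[i]) m n :
  \sum_(m <= l < n) cmod (Y l).1 <= \sum_(m <= l < n) psize (Y l).
Proof. by apply: ler_sum => l _; rewrite lerDl cmod_ge0. Qed.

Lemma sum_snd_le (Y : nat -> R[i] * R[i]) m n :
  \sum_(m <= l < n) cmod (Y l).2 <= \sum_(m <= l < n) psize (Y l).
Proof. by apply: ler_sum => l _; rewrite lerDr cmod_ge0. Qed.

Lemma psize_coord_le1 (Y : nat -> R[i] * R[i]) :
  (forall N, \sum_(0 <= l < N) psize (Y l) <= 1) ->
  forall l, cmod (Y l).1 <= 1 /\ cmod (Y l).2 <= 1.
Proof.
move=> Y1 l; have : psize (Y l) <= 1.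
  apply: le_trans (Y1 l.+1); rewrite big_nat_recr//= lerDr.
  by apply: sumr_ge0 => *; exact: psize_ge0.
by move=> Yl1; split; apply: (le_trans _ Yl1); rewrite ?lerDl ?lerDr cmod_ge0.
Qed.

(** A single time [n] must serve both components, as density in the square requires. *)
Definition hits (K : set (R * R)) (m : nat) (v1 v2 : cseq R) (tol : R)
    (Y : nat -> R[i] * R[i]) : Prop :=
  forall c, K c -> exists2 n, (1 <= n)%N &
    norm_le X (resid alpha m v1 c.1 n (fst \o Y)) tol /\
    norm_le X (resid alpha m v2 c.2 n (snd \o Y)) tol.

(** The choices come in the order [eta1], [q], [eps], [F], [M'], [eta'], each depending on the
    previous ones. In the bound of [resid_block_le], the terms with [eps], [eta1] and [eta'] each
    receive a third of [tol]. *)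
Lemma hits_step (x y : cseq R) (K : set (R * R)) (r : R) (m L0 : nat)
    (v1 v2 : cseq R) (tol : R) (M : nat) (eta : R) :
  compact K -> 0 < r ->
  (forall c, K c -> r^-1 <= c.1 <= r /\ r^-1 <= c.2 <= r) ->
  (forall eps : R, 0 < eps -> forall c, K c -> exists2 n, (1 <= n)%N &
     norm_le X (e0_dist alpha x c.1 n) eps /\ norm_le X (e0_dist alpha y c.2 n) eps) ->
  (forall j, (L0 <= j)%N -> v1 j = 0 /\ v2 j = 0) -> 0 < tol -> 0 < eta ->
  exists M' (eta' : R) h,
    [/\ (M < M')%N, 0 < eta', forall l, ~~ (M <= l < M')%N -> h l = 0,
        \sum_(M <= l < M') psize (h l) <= eta &
        forall Y, (forall l, (M <= l < M')%N -> Y l = h l) ->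
          (forall N, \sum_(0 <= l < N) psize (Y l) <= 1) ->
          (forall N, \sum_(M' <= l < N) psize (Y l) <= eta') ->
          hits K m v1 v2 tol Y].
Proof.
move=> Kc r0 Kr hK vsupp tol0 eta0.
have /choice[rho1 rho1E] (j : nat) := complex_root m (v1 j).
have /choice[rho2 rho2E] (j : nat) := complex_root m (v2 j).
pose V := \sum_(0 <= j < L0) psize (v1 j, v2 j).
have V0 : 0 <= V by apply: sumr_ge0 => j _; exact: psize_ge0.
have vV j : cmod (v1 j) <= V /\ cmod (v2 j) <= V.
  have [jL|Lj] := ltnP j L0; last by have [-> ->] := vsupp j Lj; rewrite cmod0.
  have : psize (v1 j, v2 j) <= V.
    rewrite /V big_mkord (bigD1 (Ordinal jL))//= lerDl.
    by apply: sumr_ge0 => i _; exact: psize_ge0.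
  rewrite /psize/=; have := cmod_ge0 (v1 j); have := cmod_ge0 (v2 j).
  by split; lra.
pose D := L0%:R * V.
have D0 : 0 <= D by apply: mulr_ge0.
(* Each of the two components gets half of [eta]; adding 1 to [D] avoids a zero denominator. *)
pose eta1 := Num.min (eta / 2) (tol / (6 * (D + 1))).
have eta1_gt0 : 0 < eta1 by rewrite lt_min !divr_gt0// mulr_gt0// ltr_wpDl.
have eta1_eta : 2 * eta1 <= eta.
  by rewrite mulrC -ler_pdivlMr// ge_min lexx.
have eta1_tol : 2 * D * eta1 <= tol / 3.
  have : (D + 1) * eta1 <= tol / 6.
    have h : eta1 <= tol / (6 * (D + 1)) by rewrite ge_min lexx orbT.
    apply: le_trans (ler_wpM2l _ h) _; first by rewrite addr_ge0.
    have D1 : 0 < D + 1 by rewrite ltr_wpDl.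
    rewrite le_eqVlt; apply/orP; left; apply/eqP; field.
    by rewrite gt_eqF.
  have := eta1_gt0; lra.
have C0 : 0 <= (1 + V) * expR (r * npow L0) by rewrite mulr_ge0 ?expR_ge0 ?addr_ge0.
have c0 : 0 < (r * m.+1%:R)^-1 by rewrite invr_gt0 mulr_gt0// ltr0n.
have [Q HQ] := npow_decay halpha C0 c0 eta1_gt0.
pose q := (maxn Q (maxn M.+1 L0.+1)).
have Mq : (M < q)%N by rewrite /q !leq_max leqnn orbT.
have L0q : (L0 <= q)%N by rewrite /q !leq_max (leqnSn L0) !orbT.
have {}HQ := HQ q (leq_maxl _ _).
have q0 : (0 < q)%N by apply: leq_ltn_trans Mq.
have pq1 := npow_ge1 halpha q0.
(* The coefficient of [eps] in the bound of [resid_block_le], for [kappa = 5 * eps] as given by the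
   cover. *)
pose H := 10 * D * npow q + 8 * V * expR (2 * r * npow q) * q%:R.
have H0 : 0 <= H.
  by rewrite addr_ge0 ?mulr_ge0 ?expR_ge0 ?npow_ge0.
pose eps := Num.min (10 * npow q)^-1 (tol / (3 * (H + 1))).
have eps_gt0 : 0 < eps.
  by rewrite lt_min invr_gt0 divr_gt0 ?mulr_gt0// ?(lt_le_trans _ pq1)// ltr_wpDl.
have eps_q : 5 * eps * npow q <= 2^-1.
  have h : eps <= (10 * npow q)^-1 by rewrite ge_min lexx.
  have pq0 : 0 < npow q by apply: lt_le_trans pq1.
  have -> : 2^-1 = 5 * (10 * npow q)^-1 * npow q by field; rewrite gt_eqF.
  by rewrite ler_pM2r// ler_pM2l.
have eps2 : eps <= 2^-1.
  have : eps * 1 <= eps * npow q by rewrite ler_pM2l.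
  by move: eps_q; rewrite -mulrA; have := eps_gt0; lra.
have eps_tol : H * eps <= tol / 3.
  have h : eps <= tol / (3 * (H + 1)) by rewrite ge_min lexx orbT.
  have H1 : 0 < H + 1 by rewrite ltr_wpDl.
  apply: (@le_trans _ _ ((H + 1) * eps)); first by rewrite ler_pM2r// lerDl.
  apply: le_trans (ler_wpM2l (ltW H1) h) _.
  by rewrite le_eqVlt; apply/orP; left; apply/eqP; field; rewrite gt_eqF.
have eps_rng : 0 < eps <= 2^-1 by rewrite eps_gt0.
have [F [N [A [B [FN FK Fo Fc]]]]] := compact_e0_cover halpha hX Kc eps_rng (hK _ eps_gt0).
have F_gt0 n : F n -> (0 < n)%N by move/FN => /andP[].
have F_lt n : F n -> (n < N)%N by move/FN => /andP[].
(* All blocks end before this index, and the successor ensures [q <= M'] even when [N] is 0. *)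
pose M' := (q * N.+1)%N.
pose eta' := tol / (6 * expR (r * npow M')).
pose b1 := block alpha F A m q L0 rho1.
pose b2 := block alpha F B m q L0 rho2.
have qM : (q <= M')%N by rewrite leq_pmulr.
have bsum (rho v : cseq R) (C : nat -> R) : (forall n, F n -> r^-1 <= C n <= r) ->
    (forall j, rho j ^+ m.+1 = v j) -> (forall j, cmod (v j) <= V) ->
    let b := block alpha F C m q L0 rho in
    (forall k, \sum_(q <= l < k) cmod (b l) <= eta1) /\ forall l, cmod (b l) <= eta1.
  move=> CF rhoE vle b.
  have bs k : \sum_(q <= l < k) cmod (b l) <= eta1.
    apply: le_trans (HQ k); apply: ler_sum => l _.
    exact: (block_le halpha q L0 r0 CF rhoE vle l).
  split=> // l; have [lq|ql] := ltnP l q.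
    by rewrite /b block_lt// cmod0 ltW.
  apply: le_trans (bs l.+1); rewrite big_nat_recr//= lerDr.
  by apply: sumr_ge0 => *; exact: cmod_ge0.
have A_rng n : F n -> r^-1 <= A n <= r by move=> /FK/Kr[].
have B_rng n : F n -> r^-1 <= B n <= r by move=> /FK/Kr[].
have [b1s b1le] := bsum _ _ _ A_rng rho1E (fun j => (vV j).1).
have [b2s b2le] := bsum _ _ _ B_rng rho2E (fun j => (vV j).2).
have eta'0 : 0 < eta' by rewrite divr_gt0 ?mulr_gt0 ?expR_gt0.
exists M', eta', (fun l => (b1 l, b2 l)); split=> //.
- exact: leq_trans qM.
- move=> l; rewrite negb_and -ltnNge -leqNgt => /orP[lM|Ml].
    have lq : (l < q)%N by apply: ltn_trans Mq.
    by rewrite /b1 /b2 !block_lt.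
  have ql : (q * N <= l)%N by apply: leq_trans Ml; rewrite leq_mul2l leqnSn orbT.
  by rewrite /b1 /b2 !(block_ge _ _ _ _ _ q0 F_lt ql).
- rewrite (big_cat_nat (ltnW Mq) qM)/= big_nat big1 ?add0r; last first.
    move=> l /andP[_ lq]; rewrite /psize /b1 /b2 /= !block_lt// cmod0 addr0//.
  by rewrite big_split/=; apply: le_trans (lerD (b1s M') (b2s M')) _; lra.
- move=> Y YE Y1 Ytail c Kc'; have [n Fn [cA cB]] := Fc c Kc'.
  have [c1r c2r] := Kr c Kc'.
  exists (q * n)%N; first by rewrite muln_gt0 q0 F_gt0.
  have FM k : F k -> (q * k.+1 <= M')%N.
    by move=> /F_lt kN; rewrite leq_mul2l ltnS ltnW ?orbT.
  have tolE : L0%:R * (V * (2 * (5 * eps * npow q)) + 2 * V * eta1) +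
      8 * V * expR (2 * r * npow q) * (q%:R * eps) +
      2 * expR (r * npow M') * eta' <= tol.
    have -> : L0%:R * (V * (2 * (5 * eps * npow q)) + 2 * V * eta1) +
      8 * V * expR (2 * r * npow q) * (q%:R * eps) = H * eps + 2 * D * eta1.
      by rewrite /H /D; ring.
    have -> : 2 * expR (r * npow M') * eta' = tol / 3.
      by rewrite /eta'; field; rewrite gt_eqF// expR_gt0.
    have := eps_tol; have := eta1_tol; lra.
  have comp (x' rho v Y' : cseq R) (C : nat -> R) (a : R) :
      (forall n, F n -> norm_le X (e0_dist alpha x' (C n) n) eps) ->
      (forall n, F n -> r^-1 <= C n <= r) ->
      (forall j, rho j ^+ m.+1 = v j) -> (forall j, cmod (v j) <= V) ->
      (forall j, (L0 <= j)%N -> v j = 0) ->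
      (forall l, cmod (block alpha F C m q L0 rho l) <= eta1) ->
      `|a - C n| <= 5 * eps / npow n -> r^-1 <= a <= r ->
      (forall l, (q <= l < M')%N -> Y' l = block alpha F C m q L0 rho l) ->
      (forall k, \sum_(0 <= l < k) cmod (Y' l) <= 1) ->
      (forall k, \sum_(M' <= l < k) cmod (Y' l) <= eta') ->
      norm_le X (resid alpha m v a (q * n) Y') tol.
    move=> x'o C_rng rhoE vle vs ble aC ar Y'E Y'1 Y't.
    have := resid_block_le halpha hX F_gt0 r0 C_rng eps2 x'o q0 L0q rhoE vle vs Fn aC eps_q.
    move=> /(_ Y' M' eta1 eta') h; apply: (le_trans (h _ _ _ _ _ _)) => //.
    - case/andP: ar => a1 ->; rewrite andbT; apply: le_trans a1.
      by rewrite invr_ge0 ltW.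
    - move=> l; apply: le_trans (Y'1 l.+1); rewrite big_nat_recr//= lerDr.
      by apply: sumr_ge0 => *; exact: cmod_ge0.
  split.
    apply: (comp x rho1 _ _ A) => //.
    + by move=> k /Fo[].
    + by move=> j; case: (vV j).
    + by move=> j /vsupp[].
    + by move=> l /andP[ql lM]; rewrite /= YE// lM andbT (leq_trans (ltnW Mq)).
    + by move=> k; apply: le_trans (sum_fst_le _ _ _) (Y1 k).
    + by move=> k; apply: le_trans (sum_fst_le _ _ _) (Ytail k).
  apply: (comp y rho2 _ _ B) => //.
  + by move=> k /Fo[].
  + by move=> j; case: (vV j).
  + by move=> j /vsupp[].
  + by move=> l /andP[ql lM]; rewrite /= YE// lM andbT (leq_trans (ltnW Mq)).
  + by move=> k; apply: le_trans (sum_snd_le _ _ _) (Y1 k).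
  + by move=> k; apply: le_trans (sum_snd_le _ _ _) (Ytail k).
Qed.
End Stage.

(** * Polynomial images *)

Lemma poly_bounded (R : realType) (P : {poly R[i]}) :
  exists2 C : R, 0 <= C & forall z, cmod z <= 1 -> cmod P.[z] <= C.
Proof.
elim/poly_ind: P => [|P c [C C0 PC]].
  by exists 0 => // z _; rewrite horner0 cmod0.
exists (C + cmod c); first by rewrite addr_ge0 ?cmod_ge0.
move=> z z1; rewrite hornerD hornerMX hornerC; apply: le_trans (cmodD _ _) _.
rewrite lerD2r cmodM -[leRHS]mulr1; apply: ler_pM; rewrite ?cmod_ge0//.
exact: PC.
Qed.

Lemma poly_lipschitz0 (R : realType) (P : {poly R[i]}) :
  exists2 C : R, 0 <= C & forall z, cmod z <= 1 -> cmod (P.[z] - P.[0]) <= C * cmod z.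
Proof.
elim/poly_ind: P => [|P c _]; first by exists 0 => // z _; rewrite !horner0 subrr cmod0 mul0r.
have [C C0 PC] := poly_bounded P; exists C => // z z1.
rewrite !hornerD !hornerMX !hornerC mulr0 add0r addrK cmodM.
by apply: ler_wpM2r; [exact: cmod_ge0|exact: PC].
Qed.

Definition rat_complex (R : realType) (p : rat * rat) : R[i] :=
  (ratr p.1 +i* ratr p.2)%C.

Lemma rat_complex_dense (R : realType) (z : R[i]) (d : R) : 0 < d ->
  exists p, cmod (rat_complex R p - z) <= d.
Proof.
move=> d0; have d2 : 0 < d / 2 by rewrite divr_gt0.
have H (x : R) : exists p : rat, `|ratr p - x| <= d / 2.
  have [|p] := @rat_in_itvoo R (x - d / 2) (x + d / 2); first by lra.
  rewrite in_itv/= => /andP[p1 p2]; exists p.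
  by rewrite ler_norml; apply/andP; split; lra.
case: z => a b; have [p pa] := H a; have [p' pb] := H b; exists (p, p').
rewrite /cmod /rat_complex /=.
set s := ratr p - a in pa *; set t := ratr p' - b in pb *.
have -> : d = Num.sqrt (d ^+ 2) by rewrite sqrtr_sqr gtr0_norm.
have := normr_ge0 s; have := normr_ge0 t.
rewrite ler_sqrt ?sqr_ge0// -(real_normK (num_real s)) -(real_normK (num_real t)).
by nra.
Qed.

(** Targets are coded by elements of a countable type, so that they can be enumerated by [unpickle];
    the default pair makes them finitely supported. *)
Definition rat_seq (R : realType) (s : seq (rat * rat)) : cseq R :=
  fun j => rat_complex R (nth (0, 0) s j).

Lemma rat_seq_ge (R : realType) (s : seq (rat * rat)) j :
  (size s <= j)%N -> rat_seq R s j = 0.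
Proof. by move=> sj; rewrite /rat_seq nth_default// /rat_complex/= !rmorph0. Qed.

Section Algebra.
Variables (R : realType) (alpha : R) (X : normed_subspace R (cseq R)).
Hypotheses (halpha : 0 < alpha <= 1) (hX : lp_or_c0 X).
Local Notation npow := (npow alpha).
Local Notation gain := (gain alpha).

(** The scalar [c] will be the lowest nonzero coefficient of a polynomial. Half of [e] pays for
    truncating [u], the other half for approximating the remaining entries of [u / c]. *)
Lemma rat_seq_dense (c : R[i]) (u : cseq R) (e : R) : c != 0 -> carrier X u -> 0 < e ->
  exists s, norm_le X (fun j => cmod (c * rat_seq R s j - u j)) e.
Proof.
move=> c0 uX e0; have e2 : 0 < e / 2 by rewrite divr_gt0.
have [N uN] := trunc_dense hX uX e2.
have cc : 0 < cmod c by rewrite lt_def cmod_ge0 cmod_eq0 c0.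
have d0 : 0 < e / 2 / N.+1%:R / cmod c by rewrite !divr_gt0// ltr0n.
have /choice[p pP] (j : nat) := rat_complex_dense (u j / c) d0.
exists (mkseq p N).
pose g1 j := if (j < N)%N then e / 2 / N.+1%:R else 0.
pose g2 j := cmod (if (j < N)%N then 0 else u j).
have g1_ge0 j : 0 <= g1 j by rewrite /g1; case: ifP => // _; rewrite divr_ge0// ltW.
have g2_ge0 j : 0 <= g2 j by exact: cmod_ge0.
apply: (@norm_le_mono _ _ hX _ (fun j => g1 j + g2 j)).
  move=> j; rewrite cmod_ge0/= /g1 /g2; case: ltnP => jN.
    rewrite cmod0 addr0 /rat_seq nth_mkseq//.
    have -> : c * rat_complex R (p j) - u j = c * (rat_complex R (p j) - u j / c).
      by rewrite mulrBr mulrCA divff// mulr1.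
    by rewrite cmodM mulrC -ler_pdivlMr.
  by rewrite rat_seq_ge ?size_mkseq// mulr0 sub0r cmodN add0r.
have -> : e = e / 2 + e / 2 by lra.
apply: norm_leD => //.
  apply: norm_le_l1 => // M.
  apply: (@le_trans _ _ (\sum_(0 <= j < N + M) g1 j)).
    by rewrite [leRHS](big_cat_nat (leq0n M) (leq_addl _ _))//= lerDl sumr_ge0.
  rewrite (big_cat_nat (leq0n N) (leq_addr _ _))//= [X in _ + X]big_nat.
  rewrite [X in _ + X]big1 ?addr0; last first.
    by move=> j /andP[Nj _]; rewrite /g1 ltnNge Nj.
  rewrite (eq_big_nat _ _ (F2 := fun=> e / 2 / N.+1%:R)).
    rewrite sumr_const_nat subn0 -mulrnAr ler_piMr ?(ltW e2)//.
    by rewrite -[leLHS]mulr_natl ler_pdivrMr ?ltr0n// mul1r ler_nat.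
  by move=> j /andP[_ jN]; rewrite /g1 jN.
by apply: norm_le_enorm uN => // j; rewrite ger0_norm.
Qed.

(** Write [P] as [Q * 'X^m.+1] with [Q.[0] != 0]. Replacing [Q] by the constant [Q.[0]] costs a
    multiple of the next power of the modulus, which is the second term of [resid]. *)
Lemma poly_orbit_le (P : {poly R[i]}) : P != 0 -> P.[0] = 0 ->
  exists (m : nat) (c : R[i]) (C : R), [/\ c != 0, 0 <= C &
    forall (Y : cseq R), (forall l, cmod (Y l) <= 1) ->
    forall (v u : cseq R) (a : R) (n : nat) (tol e : R),
      norm_le X (resid alpha m v a n Y) tol ->
      norm_le X (fun j => cmod (c * v j - u j)) e ->
      norm_le X (fun j => cmod ((gain a n j)%:C%C * P.[Y (n + j)%N] - u j))
        (C * tol + e)].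
Proof.
move=> P0 P00; have [m [Q /implyP/(_ P0) Q0 PE]] := multiplicity_XsubC P 0.
have c0 : Q.[0] != 0 by rewrite -rootE.
(* Multiplicity 0 is excluded, since then [P.[0]] would be [Q.[0]]. *)
case: m PE => [|m] PE.
  by move: c0; rewrite -[Q]mulr1 -[1]/(('X - 0%:P) ^+ 0) -PE P00 eqxx.
have [C C0 QC] := poly_lipschitz0 Q.
exists m, Q.[0], (cmod Q.[0] + C); split=> //; first by rewrite addr_ge0 ?cmod_ge0.
move=> Y Y1 v u a n tol e htol he.
have C1 : 0 <= cmod Q.[0] + C by rewrite addr_ge0 ?cmod_ge0.
have r0 j : 0 <= resid alpha m v a n Y j.
  by rewrite addr_ge0 ?cmod_ge0// mulr_ge0 ?exprn_ge0 ?cmod_ge0 ?expR_ge0.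
apply: (@norm_le_mono _ _ hX _ (fun j => (cmod Q.[0] + C) * resid alpha m v a n Y j +
    cmod (Q.[0] * v j - u j))); last first.
  apply: norm_leD => //; last by exact: norm_leZ.
    by move=> j; apply: mulr_ge0.
  by move=> j; exact: cmod_ge0.
move=> j; rewrite cmod_ge0/=.
have -> : P.[Y (n + j)%N] = Q.[Y (n + j)%N] * Y (n + j)%N ^+ m.+1.
  by rewrite PE hornerM horner_exp subr0 hornerX.
set W := (gain a n j)%:C%C; set y := Y (n + j)%N.
have -> : W * (Q.[y] * y ^+ m.+1) - u j = Q.[0] * (W * y ^+ m.+1 - v j) +
    (Q.[y] - Q.[0]) * (W * y ^+ m.+1) + (Q.[0] * v j - u j) by ring.
apply: le_trans (cmodD _ _) _; rewrite lerD2r; apply: le_trans (cmodD _ _) _.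
rewrite !cmodM -/y cmodX /resid -/W -/y.
have W0 : cmod W = gain a n j by rewrite cmod_real ger0_norm// expR_ge0.
rewrite W0; have g0 := gain_gt0 alpha a n j.
set R1 := cmod (_ - v j); have R10 : 0 <= R1 by exact: cmod_ge0.
have h : cmod (Q.[y] - Q.[0]) * (gain a n j * cmod y ^+ m.+1) <=
    C * (gain a n j * cmod y ^+ m.+2).
  rewrite [cmod y ^+ m.+2]exprS.
  have -> : C * (gain a n j * (cmod y * cmod y ^+ m.+1)) =
    C * cmod y * (gain a n j * cmod y ^+ m.+1) by ring.
  apply: ler_wpM2r; last exact: QC (Y1 _).
  by rewrite mulr_ge0 ?exprn_ge0 ?cmod_ge0// ltW.
apply: le_trans (lerD (lexx _) h) _.
have c10 := cmod_ge0 Q.[0].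
have : 0 <= gain a n j * cmod y ^+ m.+2 by rewrite mulr_ge0 ?exprn_ge0 ?cmod_ge0// ltW.
move: (cmod Q.[0]) (gain a n j * cmod y ^+ m.+2) c10 => q t q0 t0.
rewrite mulrDl !mulrDr; have := mulr_ge0 C0 R10; have := mulr_ge0 q0 t0; lra.
Qed.

End Algebra.

(** * From a common hypercyclic vector to a common hypercyclic algebra *)

Section CommonAlgebra.
Variables (R : realType) (alpha : R) (X : normed_subspace R (cseq R)).
Variables (L : set (R * R)) (w : R -> nat -> R).
Hypotheses (halpha : 0 < alpha <= 1) (hX : lp_or_c0 X) (hL : sigma_compact L).
Hypothesis hw : forall (a : R) (n : nat), (1 <= n)%N ->
  \prod_(1 <= k < n.+1) w a k = expR (a * npow alpha n).

Let T (c : R * R) := product_map (weighted_shift (w c.1)) (weighted_shift (w c.2)).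

Lemma universal_pair (z : cseq R * cseq R) :
  common_hypercyclic_vector (square_space X) L T z ->
  exists Y : nat -> R[i] * R[i], (forall N, \sum_(0 <= l < N) psize (Y l) <= 1) /\
    forall m s1 s2 (tol : R), 0 < tol ->
      hits alpha X L m (rat_seq R s1) (rat_seq R s2) tol Y.
Proof.
move=> [_ hz]; have [K [Kc LE]] := hL.
(* These compact pieces keep the parameters away from 0 and infinity, as the blocks require. They
   exhaust [L], whose parameters are positive by [HC_param_gt0]. *)
pose Kr (k i : nat) := K k `&` (`[i.+1%:R^-1, i.+1%:R] `*` `[i.+1%:R^-1, i.+1%:R])%classic.
have Krc k i : compact (Kr k i).
  apply: compact_closedI; first exact: Kc.
  rewrite -[_ `*` _]/(fst @^-1` _ `&` snd @^-1` _).
  by apply: closedI; apply: preimage_closed => [? _|]; [exact: cvg_fst|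
    exact: interval_closed|exact: cvg_snd|exact: interval_closed].
have KL k c : K k c -> L c by rewrite LE => Kkc; exists k.
pose task : Type := (nat * nat * nat * nat * seq (rat * rat) * seq (rat * rat))%type.
(* Step [s] handles the task coded by [s]; a number that codes no task imposes nothing and is met by
   a zero hump of length 1. *)
pose G (s : nat) (Y : nat -> R[i] * R[i]) : Prop :=
  match unpickle s : option task with
  | Some (m, k, i, t, s1, s2) =>
      hits alpha X (Kr k i) m (rat_seq R s1) (rat_seq R s2) t.+1%:R^-1 Y
  | None => True
  end.
have [|Y [Y1 GY]] := @gliding_hump R _ (@psize R) G (@psize_ge0 R).
  move=> s M eta eta0; rewrite /G; case: unpickle => [[[[[[m k] i] t] s1] s2]|]; last first.
    exists M.+1, 1, (fun=> 0); split=> //.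
    by rewrite big1 ?ltW// => l _; exact: psize0.
  apply: (@hits_step _ alpha X halpha hX z.1 z.2 _ i.+1%:R m
    (maxn (size s1) (size s2))) => //.
  - by move=> c [_ [/=]]; rewrite !in_itv.
  - move=> eps eps0 c [/KL Lc _].
    have e0E : (fun j : nat => (1 * (j == 0%N)%:R)%:C%C : R[i]) = fun j => (j == 0%N)%:R.
      by apply/funext => -[|j] /=; rewrite ?mulr1 ?mulr0.
    have e0X := carrier_e0 hX 1; rewrite e0E in e0X.
    by have := HC_orbit halpha hX (hw c.1) (hw c.2) (hz c Lc) e0X e0X eps0.
  - by move=> j; rewrite geq_max => /andP[h1 h2]; rewrite !rat_seq_ge.
exists Y; split=> // m s1 s2 tol tol0 c Lc.
have [k Kkc] : exists k, K k c by move: Lc; rewrite LE => -[k]; exists k.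
have [c1 c2] := HC_param_gt0 halpha hX (hw c.1) (hw c.2) (hz c Lc).
pose t := Num.bound tol^-1.
have tP : t.+1%:R^-1 <= tol.
  rewrite invf_ple ?posrE ?ltr0n//; apply/ltW.
  apply: (lt_trans (archi_boundP _)); first by rewrite invr_ge0 ltW.
  by rewrite ltr_nat.
have bnd (x : R) : 0 < x -> exists i0, forall i, (i0 <= i)%N -> i.+1%:R^-1 <= x <= i.+1%:R.
  move=> x0; exists (Num.bound x + Num.bound x^-1)%N => i hi.
  have [xV0 x0'] : 0 <= x^-1 /\ 0 <= x by split; rewrite ?invr_ge0 ltW.
  rewrite invf_ple ?posrE ?ltr0n//; apply/andP; split; apply/ltW.
    apply: (lt_le_trans (archi_boundP xV0)); rewrite ler_nat.
    by apply: leq_trans (leqW hi); exact: leq_addl.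
  apply: (lt_le_trans (archi_boundP x0')); rewrite ler_nat.
  by apply: leq_trans (leqW hi); exact: leq_addr.
have [i1 h1] := bnd _ c1; have [i2 h2] := bnd _ c2.
pose i := maxn i1 i2.
have := GY (pickle ((m, k, i, t, s1, s2) : task)); rewrite /G pickleK => /(_ c).
have Krc' : Kr k i c.
  by split=> //; split=> /=; rewrite in_itv/=; [apply: h1|apply: h2];
    rewrite leq_max leqnn ?orbT.
move=> /(_ Krc')[n n1 [r1 r2]]; exists n => //.
by split; [apply: le_trans r1 _|apply: le_trans r2 _]; rewrite lee_fin.
Qed.

(** For [P.[0] = 0] these are the elements of the algebra generated by [Y]. *)
Definition poly_image (Y : nat -> R[i] * R[i]) (P : {poly R[i]}) : cseq R * cseq R :=
  (fun n => P.[(Y n).1], fun n => P.[(Y n).2]).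

Lemma poly_image_hypercyclic (Y : nat -> R[i] * R[i]) (P : {poly R[i]}) (c : R * R) :
  (forall N, \sum_(0 <= l < N) psize (Y l) <= 1) ->
  (forall m s1 s2 (tol : R), 0 < tol ->
      hits alpha X L m (rat_seq R s1) (rat_seq R s2) tol Y) ->
  L c -> P != 0 -> P.[0] = 0 ->
  dense_in (square_space X) [set y | exists2 n, (1 <= n)%N & y = iter n (T c) (poly_image Y P)].
Proof.
move=> Y1 hY Lc P0 P00 [u1 u2] [/= u1X u2X] e e0.
have [m [b [C [b0 C0 HP]]]] := poly_orbit_le alpha hX P0 P00.
have e4 : 0 < e / 4 by rewrite divr_gt0.
have [s1 hs1] := rat_seq_dense hX b0 u1X e4.
have [s2 hs2] := rat_seq_dense hX b0 u2X e4.
have C1 : 0 < C + 1 by rewrite ltr_wpDl.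
(* With this tolerance the error [C * tol + e / 4] is at most [e / 2], which gives the strict
   inequality. *)
have tol0 : 0 < e / 4 / (C + 1) by rewrite divr_gt0.
have [n n1 [r1 r2]] := hY m s1 s2 _ tol0 c Lc.
have Y1l l := (psize_coord_le1 Y1 l).1; have Y2l l := (psize_coord_le1 Y1 l).2.
have q1 := HP (fst \o Y) Y1l _ _ _ _ _ _ r1 hs1.
have q2 := HP (snd \o Y) Y2l _ _ _ _ _ _ r2 hs2.
exists (iter n (T c) (poly_image Y P)); first by exists n.
have tole : C * (e / 4 / (C + 1)) + e / 4 < e.
  have : C * (e / 4 / (C + 1)) <= e / 4.
    by rewrite mulrCA ler_piMr ?(ltW e4)// ler_pdivrMr// mul1r lerDl.
  lra.
rewrite (iter_shiftE halpha (hw c.1) (hw c.2)) /= gt_max; apply/andP; split.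
  apply: le_lt_trans (_ : _ <= (C * (e / 4 / (C + 1)) + e / 4)%:E)%E _; last by rewrite lte_fin.
  exact: (enorm_norm_le hX _ q1).
apply: le_lt_trans (_ : _ <= (C * (e / 4 / (C + 1)) + e / 4)%:E)%E _; last by rewrite lte_fin.
exact: (enorm_norm_le hX _ q2).
Qed.

Lemma poly_image_carrier (Y : nat -> R[i] * R[i]) (P : {poly R[i]}) :
  (forall N, \sum_(0 <= l < N) psize (Y l) <= 1) -> P.[0] = 0 ->
  carrier (square_space X) (poly_image Y P).
Proof.
move=> Y1 P00; have [C C0 PC] := poly_lipschitz0 P.
have Y1l l := (psize_coord_le1 Y1 l).1; have Y2l l := (psize_coord_le1 Y1 l).2.
have PC' z : cmod z <= 1 -> cmod P.[z] <= C * cmod z by move=> /PC; rewrite P00 subr0.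
split; apply: (carrier_l1 hX (s := C)) => N /=.
  apply: (@le_trans _ _ (C * \sum_(0 <= l < N) cmod (Y l).1)).
    by rewrite mulr_sumr; apply: ler_sum => l _; exact: PC'.
  by rewrite ler_piMr//; apply: le_trans (sum_fst_le _ _ _) (Y1 N).
apply: (@le_trans _ _ (C * \sum_(0 <= l < N) cmod (Y l).2)).
  by rewrite mulr_sumr; apply: ler_sum => l _; exact: PC'.
by rewrite ler_piMr//; apply: le_trans (sum_snd_le _ _ _) (Y1 N).
Qed.

Lemma poly_image_subalgebra (Y : nat -> R[i] * R[i]) :
  (forall N, \sum_(0 <= l < N) psize (Y l) <= 1) ->
  is_subalgebra (square_space X) [set u | exists2 P, P.[0] = 0 & u = poly_image Y P].
Proof.
move=> Y1; split.
- by move=> _ [P P0 ->]; exact: poly_image_carrier.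
- exists 0; first exact: horner0.
  by congr pair; apply/funext => n /=; rewrite horner0.
- move=> _ _ [P P0 ->] [Q Q0 ->]; exists (P + Q).
    by rewrite hornerD P0 Q0 addr0.
  by congr pair; apply/funext => n /=; rewrite hornerD.
- move=> c _ [P P0 ->]; exists (c *: P); first by rewrite hornerZ P0 mulr0.
  by congr pair; apply/funext => n /=; rewrite hornerZ.
- move=> _ _ [P P0 ->] [Q Q0 ->]; exists (P * Q).
    by rewrite hornerM P0 mul0r.
  by congr pair; apply/funext => n /=; rewrite hornerM.
Qed.

Lemma common_algebra_of_vector (z : cseq R * cseq R) :
  common_hypercyclic_vector (square_space X) L T z ->
  exists A, common_hypercyclic_algebra (square_space X) L T A.
Proof.
move=> hz; have [Y [Y1 hY]] := universal_pair hz.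
(* When [L] is empty, [hY] says nothing and [Y] may vanish. The line spanned by [(e_0, 0)] is then a
   nonzero algebra, [e_0] being idempotent. *)
have [L0|/set0P[c Lc]] := eqVneq L set0.
  pose e (a : R[i]) : cseq R := fun j => a * (j == 0%N)%:R.
  have eX a : carrier X (e a).
    apply: (carrier_l1 hX (s := cmod a)) => -[|N]; first by rewrite big_geq// cmod_ge0.
    rewrite big_nat_recl// big1 ?addr0 /e ?mulr1// => j _.
    by rewrite mulr0 cmod0.
  have eA u : (exists a, u = (e a, 0)) -> carrier (square_space X) u.
    move=> [a ->]; split=> //=; have -> : 0 = e 0 :> cseq R; last exact: eX.
    by apply/funext => j; rewrite /e mul0r.
  exists [set u | exists a, u = (e a, 0)]; split.
  - split=> //.
    + by exists 0; congr pair; apply/funext => j; rewrite /e mul0r.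
    + move=> _ _ [a ->] [b ->]; exists (a + b).
      by congr pair; [apply/funext => j; rewrite /e mulrDl|exact: addr0].
    + move=> c _ [a ->]; exists (c * a).
      by congr pair; [apply/funext => j; rewrite /e -mulrA|exact: scaler0].
    + move=> _ _ [a ->] [b ->]; exists (a * b).
      congr pair; last exact: mulr0.
      apply/funext => j.
      transitivity (a * (j == 0%N)%:R * (b * (j == 0%N)%:R)) => //.
      by rewrite mulrACA -natrM mulnb andbb.
  - exists (e 1, 0); first by exists 1.
    apply/eqP => -[/(congr1 (fun f => f 0%N))]; rewrite /e mulr1 => /eqP.
    by rewrite oner_eq0.
  - by move=> u uA _; split=> [|i]; [exact: eA|rewrite L0].
exists [set u | exists2 P, P.[0] = 0 & u = poly_image Y P]; split.
- exact: poly_image_subalgebra.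
- exists (poly_image Y 'X); first by exists 'X; rewrite ?hornerX.
  apply/eqP => -[Y0 _].
  (* [Y] is nonzero: with the target [e_0] and exponent 1, a vanishing first component would give a
     residue of 1 at coordinate 0, above the tolerance 1/2. *)
  have h2 : 0 < (2^-1 : R) by rewrite invr_gt0.
  have [n _ [r1 _]] := hY 0%N [:: (1, 0)] [::] _ h2 c Lc.
  have := norm_le_coord hX 0%N r1; rewrite /resid/= addn0.
  have -> : (Y n).1 = 0.
    by have := congr1 (fun f => f n) Y0; rewrite hornerX.
  rewrite cmod0 !expr0n !mulr0 addr0 sub0r cmodN.
  have -> : rat_seq R [:: (1, 0)] 0 = 1 by rewrite /rat_seq /rat_complex/= rmorph1 rmorph0.
  by rewrite cmod1 normr1; lra.
- move=> _ [P P0 ->] u0; have Pn0 : P != 0.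
    apply: contraNneq u0 => ->; apply/eqP.
    by congr pair; apply/funext => n /=; rewrite horner0.
  split=> [|i Li]; first exact: poly_image_carrier.
  by split; [exact: poly_image_carrier|exact: poly_image_hypercyclic].
Qed.
End CommonAlgebra.

Theorem proposition1p3 (R : realType) (alpha : R)
    (X : normed_subspace R (cseq R)) (L : set (R * R)) (w : R -> nat -> R)
    (halpha : 0 < alpha <= 1)
    (hX : (exists2 p : R, 1 <= p & X = lp_space p) \/ X = c0_space R)
    (hL : sigma_compact L)
    (hw_gt0 : forall (a : R) (n : nat), (1 <= n)%N -> 0 < w a n)
    (hw : forall (a : R) (n : nat), (1 <= n)%N ->
       \prod_(1 <= k < n.+1) w a k = expR (a * n%:R `^ alpha)) :
  let T (c : R * R) :=
    product_map (weighted_shift (w c.1)) (weighted_shift (w c.2)) in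
  (exists x, common_hypercyclic_vector (square_space X) L T x) <->
  (exists A, common_hypercyclic_algebra (square_space X) L T A).
Proof.
move=> T; split=> [[x hx]|[A [_ [u Au u0] hA]]].
  exact: (common_algebra_of_vector halpha hX hL hw hx).
by exists u; exact: hA.
Qed.
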